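(* Let $F(x,y)=(x-P(x,y)+X(x,y),\; y+Q(x,y)+Y(x,y))$ be a map of the plane of the form described in the context. Suppose that the symmetric coefficient tensors $\mathscr A,\mathscr B,\mathscr C,\mathscr D,\mathscr E,\mathscr H$ of $$\frac{\partial P}{\partial x},\quad \frac{\partial Q}{\partial y},\quad \frac{\partial P}{\partial x}+\frac{\partial P}{\partial y},\quad \frac{\partial P}{\partial x}-\frac{\partial P}{\partial y},\quad \frac{\partial Q}{\partial y}+\frac{\partial Q}{\partial x},\quad \frac{\partial Q}{\partial y}-\frac{\partial Q}{\partial x},$$ respectively, are all positive definite. Let $F'=F_1\times F_2$, i.e. $F'(x,y)=(F_1(x),F_2(y))$ for $(x,y)$ near $(0,0)$, where $F_1$ and $F_2$ are the one-dimensional maps defined in the context from the restrictions of $F$ to its local stable and unstable sets at $(0,0)$. Then there are two neighborhoods $N$ and $N'$ of $(0,0)$ such that $F|_N$ is topologically conjugate to $F'|_{N'}$.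
   Context: Setting: $F=(f,g):\mathbb R^2\to\mathbb R^2$, $F(x,y)=(x-P(x,y)+X(x,y),\,y+Q(x,y)+Y(x,y))$, where $P$ and $Q$ are real homogeneous polynomials in two variables of degrees $2k+1$ and $2k'+1$ respectively, with $k,k'\ge 1$ integers, and $X,Y$ are higher-order terms than $P,Q$ respectively: $X,Y$ are $C^1$ functions with $X(0,0)=Y(0,0)=0$ and, as $(x,y)\to(0,0)$, the first partial derivatives of $X$ are $o(\|(x,y)\|^{2k})$ and those of $Y$ are $o(\|(x,y)\|^{2k'})$ (hence $X=o(\|(x,y)\|^{2k+1})$, $Y=o(\|(x,y)\|^{2k'+1})$). Thus $\mathbf 0=(0,0)$ is a fixed point of $F$. Tensors: for a real homogeneous polynomial $R$ of degree $m$ in $\mathbf x=(x_1,\dots,x_n)$, its symmetric coefficient tensor is the unique symmetric array $\mathscr B=(b_{i_1\cdots i_m})$ with $R(\mathbf x)=\mathscr B\mathbf x^m:=\sum_{i_1,\dots,i_m=1}^n b_{i_1\cdots i_m}x_{i_1}\cdots x_{i_m}$. A tensor $\mathscr B$ is positive definite if $\mathscr B\mathbf x^m>0$ for all $\mathbf x\in\mathbb R^n\setminus\{0\}$. Stable and unstable sets: for a neighborhood $N_0$ of $\mathbf 0$, $$W^s(F,N_0)=\{(x,y)\in N_0:\ F^j(x,y)\in N_0\ \forall j\ge 0,\ \lim_{j\to+\infty}F^j(x,y)=(0,0)\},$$ $$W^u(F,N_0)=\{(x,y)\in N_0:\ F^{-j}(x,y)\in N_0\ \forall j\ge 0,\ \lim_{j\to+\infty}F^{-j}(x,y)=(0,0)\},$$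 where $F^{-1}$ denotes the local inverse of $F$ near $\mathbf 0$. Under the positive definiteness hypotheses there are a neighborhood $N_0$ of $\mathbf 0$ and $\delta_0>0$ such that $W^s:=W^s(F,N_0)$ is the graph $\{(x,\varphi^s(x)):|x|\le\delta_0\}$ and $W^u:=W^u(F,N_0)$ is the graph $\{(\varphi^u(y),y):|y|\le\delta_0\}$ of Lipschitz functions $\varphi^s,\varphi^u:[-\delta_0,\delta_0]\to\mathbb R$; fix such an $N_0$. Definition of $F_1,F_2$: for $x$ close to $0$ let $\mathbf p(x)$ be the unique point of $W^s$ with first coordinate $x$; for $y$ close to $0$ let $\mathbf q(y)$ be the unique point of $W^u$ with second coordinate $y$. With $\pi_1,\pi_2$ the coordinate projections, set $F_1(x)=\pi_1(F(\mathbf p(x)))$ and $F_2(y)=\pi_2(F(\mathbf q(y)))$. Topological conjugacy of $F|_N$ and $F'|_{N'}$ (local sense, since $N$ need not be invariant): there is a homeomorphism $H:N\to N'$ with $H(F(z))=F'(H(z))$ for every $z\in N$ with $F(z)\in N$. *)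

(* Defs.v *)
From HB Require Import structures.
From mathcomp Require Import all_boot all_order all_algebra all_fingroup.
(* The notations of mpoly clash with those of the analysis library. *)
From mathcomp Require Import -(notations) mpoly.
From mathcomp Require Import all_classical all_reals all_analysis.

Set Implicit Arguments.
Unset Strict Implicit.
Unset Printing Implicit Defensive.

Import Order.TTheory GRing.Theory Num.Theory.
Import numFieldNormedType.Exports.

Local Open Scope classical_set_scope.
Local Open Scope ring_scope.

(* An array (b_{i_1 ... i_m}) with 1 <= i_l <= n is indexed by the multi-index
   l |-> i_l. *)
Definition tensor (R : realType) (m n : nat) : Type :=
  {ffun 'I_n ^ m -> R}.

Definition tensor_symmetric (R : realType) (m n : nat) (B : tensor R m n) :
    Prop :=
  forall (s : {perm 'I_m}) (i : {ffun 'I_m -> 'I_n}),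
    B [ffun l => i (s l)] = B i.

Definition tensor_form (R : realType) (m n : nat) (B : tensor R m n)
    (x : 'rV[R]_n) : R :=
  \sum_(i : {ffun 'I_m -> 'I_n}) B i * \prod_(l < m) x ord0 (i l).

Definition tensor_posdef (R : realType) (m n : nat) (B : tensor R m n) : Prop :=
  forall x : 'rV[R]_n, x != 0 -> 0 < tensor_form B x.

Definition is_coefficient_tensor (R : realType) (m n : nat)
    (p : mpoly n R) (B : tensor R m n) : Prop :=
  tensor_symmetric B /\
  forall x : 'rV[R]_n, meval (fun i => x ord0 i) p = tensor_form B x.

Definition homogeneous (R : realType) (n d : nat) (p : mpoly n R) : Prop :=
  p \is ishomog1 d mdeg.

(* Bivariate polynomials: the variable x has index 0 and y has index 1. *)
Definition polyfun (R : realType) (p : mpoly 2 R) (z : R * R) : R :=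
  meval (fun i : 'I_2 => if i == ord0 then z.1 else z.2) p.

Definition dpx (R : realType) (p : mpoly 2 R) : mpoly 2 R := mderiv ord0 p.
Definition dpy (R : realType) (p : mpoly 2 R) : mpoly 2 R := mderiv ord_max p.

Definition dx (R : realType) (h : R * R -> R) (z : R * R) : R :=
  'D_((1, 0) : R * R) h z.
Definition dy (R : realType) (h : R * R -> R) (z : R * R) : R :=
  'D_((0, 1) : R * R) h z.

Definition C1 (R : realType) (h : R * R -> R) : Prop :=
  [/\ forall z, derivable h z (1, 0), forall z, derivable h z (0, 1),
      continuous (dx h) & continuous (dy h)].

(* The norm on R * R is the sup norm. *)
Definition higher_order (R : realType) (d : nat) (h : R * R -> R) : Prop :=
  [/\ C1 h, h (0, 0) = 0,
      dx h =o_ (nbhs ((0, 0) : R * R)) (fun z => `|z| ^+ d) &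
      dy h =o_ (nbhs ((0, 0) : R * R)) (fun z => `|z| ^+ d)].

Definition planar_map (R : realType) (P Q : mpoly 2 R) (X Y : R * R -> R)
    (z : R * R) : R * R :=
  (z.1 - polyfun P z + X z, z.2 + polyfun Q z + Y z).

(* G, total but only relevant on V, is the inverse of F : U -> V, where U and V
   are open neighborhoods of the origin. *)
Definition local_inverse (R : realType) (F G : R * R -> R * R)
    (U V : set (R * R)) : Prop :=
  [/\ open U /\ open V, U (0, 0) /\ V (0, 0), set_bij U V F,
      {within V, continuous G} & forall z, U z -> G (F z) = z].

Definition stable_set (R : realType) (F : R * R -> R * R) (N0 : set (R * R)) :
    set (R * R) :=
  [set z | [/\ N0 z, forall j, N0 (iter j F z) &
               iter j F z @[j --> \oo] --> ((0, 0) : R * R)]].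

(* G stands for the local inverse of the map; N0 has to lie in its domain. *)
Definition unstable_set (R : realType) (G : R * R -> R * R)
    (N0 : set (R * R)) : set (R * R) :=
  [set z | [/\ N0 z, forall j, N0 (iter j G z) &
               iter j G z @[j --> \oo] --> ((0, 0) : R * R)]].

Definition sym_segment (R : realType) (d : R) : set R := [set t | `|t| <= d].

Definition is_x_graph (R : realType) (W : set (R * R)) (d : R) : Prop :=
  exists phi : R -> R, [lipschitz phi t | t in sym_segment d] /\
    W = [set (t, phi t) | t in sym_segment d].

Definition is_y_graph (R : realType) (W : set (R * R)) (d : R) : Prop :=
  exists phi : R -> R, [lipschitz phi t | t in sym_segment d] /\
    W = [set (phi t, t) | t in sym_segment d].

(* If W is a graph over sym_segment d, these are the unique points of W with
   the given coordinate, for t in sym_segment d; elsewhere they are junk. *)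
Definition point_over_x (R : realType) (W : set (R * R)) (t : R) : R * R :=
  get [set z | W z /\ z.1 = t].

Definition point_over_y (R : realType) (W : set (R * R)) (t : R) : R * R :=
  get [set z | W z /\ z.2 = t].

Definition stable_map (R : realType) (F : R * R -> R * R) (Ws : set (R * R))
    (x : R) : R :=
  (F (point_over_x Ws x)).1.

Definition unstable_map (R : realType) (F : R * R -> R * R) (Wu : set (R * R))
    (y : R) : R :=
  (F (point_over_y Wu y)).2.

Definition product_map (R : realType) (f1 f2 : R -> R) (z : R * R) : R * R :=
  (f1 z.1, f2 z.2).

Definition homeomorphism (R : realType) (N N' : set (R * R))
    (h : R * R -> R * R) : Prop :=
  [/\ set_bij N N' h, {within N, continuous h} &
      exists k : R * R -> R * R,
        {within N', continuous k} /\ forall z, N z -> k (h z) = z].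

Definition conjugate_on (R : realType) (F : R * R -> R * R) (N : set (R * R))
    (F' : R * R -> R * R) (N' : set (R * R)) : Prop :=
  exists h : R * R -> R * R, homeomorphism N N' h /\
    forall z, N z -> N (F z) -> h (F z) = F' (h z).

(* Main.v *)
(** The cone conditions say that F expands the second coordinate along pairs of
points in vertical position (slope at least 1 in absolute value), keeping them
in vertical position, and that the local inverse G does the same with the first
coordinate of pairs in horizontal position.

A coordinate A with A o F = F_1 o A is obtained by the fundamental domain
method. A point of a small square whose G-orbit stays in the square gets A = 0.
Otherwise, if G^n z is the last point before the orbit leaves through a vertical
side, A z = F_1^n (A (G^n z)), where A (G^n z) interpolates between r and F_1 r
according to how far G^n z and G^(n+1) z are from that side. All of this is the
limit of the iterates of one operator acting on continuous functions. A
increases along horizontal pairs: a pair on which it did not would stay in the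
square under all iterates of G while its horizontal separation grows.

The same construction for the inverse map gives B with B o F = F_2 o B,
increasing along vertical pairs. Any two points are in horizontal or vertical
position, so (A, B) is injective; by the intermediate value theorem, applied
first to A on horizontal lines and then to B along a level curve of A, its image
is a neighborhood of the origin.

Since A only needs F_1 to be an increasing contraction near 0, the stable graph
enters through F_1 alone: all F_1-orbits converge to 0, F_1 is injective near 0
and F has derivative the identity at 0. *)

Require Import Defs.
From HB Require Import structures.
From mathcomp Require Import all_boot all_order all_algebra all_fingroup.
From mathcomp Require Import -(notations) mpoly.
From mathcomp Require Import all_classical all_reals all_analysis.
From mathcomp Require Import ring lra.

Set Implicit Arguments.
Unset Strict Implicit.
Unset Printing Implicit Defensive.

Import Order.TTheory GRing.Theory Num.Theory.
Import numFieldNormedType.Exports.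

Local Open Scope classical_set_scope.
Local Open Scope ring_scope.

(** * Boxes and cones *)

Section Cones.
Context {R : realType}.
Implicit Types (z w : R * R) (r x : R).

Definition box r : set (R * R) :=
  [set z | [/\ - r <= z.1, z.1 <= r, - r <= z.2 & z.2 <= r]].

(** Horizontal position, oriented from left to right. The two slope bounds are kept apart so that
    linear arithmetic can use them directly. *)
Definition hcone z1 z2 : Prop :=
  [/\ z1.1 < z2.1, z2.2 - z1.2 <= z2.1 - z1.1 & z1.2 - z2.2 <= z2.1 - z1.1].

Definition clamp r x : R := Num.max (- r) (Num.min r x).

(** Retraction of the plane onto the box. Precomposing with it turns a map continuous on the box
    into a globally continuous one. *)
Definition clamp2 r z : R * R := (clamp r z.1, clamp r z.2).

Lemma clamp_bounds r x : 0 <= r -> - r <= clamp r x <= r.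
Proof.
move=> r0; rewrite /clamp le_max lexx /= ge_max ge_min lexx /= andbT; lra.
Qed.

Lemma clamp_id r x : - r <= x <= r -> clamp r x = x.
Proof. by case/andP=> ? ?; rewrite /clamp min_r// max_r. Qed.

Lemma clamp_ge r x : 0 <= r -> r <= x -> clamp r x = r.
Proof. by move=> ? ?; rewrite /clamp min_l// max_r//; lra. Qed.

Lemma clamp_le r x : 0 <= r -> x <= - r -> clamp r x = - r.
Proof.
by move=> r0 xr; rewrite /clamp max_l// ge_min xr orbT.
Qed.

Lemma continuous_clamp r : continuous (clamp r).
Proof.
move=> x; apply: (@continuous_max R R (cst (- r)) (cst r \min id)).
  exact: cvg_cst.
by apply: (@continuous_min R R (cst r) id); [exact: cvg_cst|exact: cvg_id].
Qed.

Lemma clamp2_box r z : 0 <= r -> box r (clamp2 r z).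
Proof.
move=> r0; have /andP[? ?] := clamp_bounds z.1 r0.
by have /andP[? ?] := clamp_bounds z.2 r0; split.
Qed.

Lemma clamp2_id r z : box r z -> clamp2 r z = z.
Proof.
by case: z => x y [/= ? ? ? ?]; rewrite /clamp2 /= !clamp_id//; apply/andP.
Qed.

Lemma continuous_pair (T : topologicalType) (f g : T -> R) :
  continuous f -> continuous g -> continuous (fun t => (f t, g t)).
Proof. by move=> cf cg t; exact: (cvg_pair (cf t) (cg t)). Qed.

Lemma continuous_fst : continuous (fst : R * R -> R).
Proof. by move=> z; exact: cvg_fst. Qed.

Lemma continuous_snd : continuous (snd : R * R -> R).
Proof. by move=> z; exact: cvg_snd. Qed.

Lemma continuous_clamp2 r : continuous (clamp2 r).
Proof.
apply: continuous_pair => z.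
  exact: (continuous_comp (@continuous_fst z) (@continuous_clamp r _)).
exact: (continuous_comp (@continuous_snd z) (@continuous_clamp r _)).
Qed.

Lemma box_compact r : compact (box r).
Proof.
have -> : box r = `[- r, r]%classic `*` `[- r, r]%classic.
  apply/seteqP; split=> [[x y] [/= ? ? ? ?]|[x y] /=].
    by rewrite /= !in_itv /=; split; apply/andP.
  by rewrite /= !in_itv /= => -[/andP[? ?] /andP[? ?]]; split.
by apply: compact_setX; exact: segment_compact.
Qed.

Lemma continuous_comp_within (T U V : topologicalType) (A : set U)
    (f : T -> U) (g : U -> V) :
  (forall t, A (f t)) -> continuous f -> {within A, continuous g} ->
  continuous (g \o f).
Proof.
move=> Af cf /subspace_continuousP cg t.
have fA : f @ nbhs t --> within A (nbhs (f t)).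
  move=> B /=; rewrite /within /= => /(cf t) /=; rewrite nbhs_simpl /=.
  by apply: filterS => x; apply; exact: Af.
exact: (cvg_comp f g fA (cg _ (Af t))).
Qed.

(** The minimum is attained when [K] is nonempty; a lower bound, unlike a minimum, also makes sense
    for empty [K]. *)
Lemma positive_lower_bound (T : topologicalType) (K : set T) (f : T -> R) :
  compact K -> {within K, continuous f} -> (forall t, K t -> 0 < f t) ->
  exists2 e : R, 0 < e & forall t, K t -> e <= f t.
Proof.
move=> cK cf f0; have [K0|/set0P K0] := eqVneq K set0.
  by exists 1 => // t; rewrite K0.
have [c /set_mem Kc fc] := compact_EVT_min K0 cK cf.
by exists (f c); [exact: f0|move=> t /mem_set /fc].
Qed.

End Cones.

(** * Semiconjugacy to an interval contraction *)

Section FiberCoordinate.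
Context {R : realType}.
Variables (r : R) (G : R * R -> R * R) (phi : R -> R).
Implicit Types (z : R * R) (A : R * R -> R).
Hypothesis r_gt0 : 0 < r.
Hypothesis G_cont : continuous (fun z => G (clamp2 r z)).
Hypothesis G0 : G (0, 0) = (0, 0).
Hypothesis G_expands : forall z1 z2, box r z1 -> box r z2 -> hcone z1 z2 ->
  hcone (G z1) (G z2) /\ z2.1 - z1.1 < (G z2).1 - (G z1).1.
Hypothesis G_exit : forall z, box r z -> - r <= (G z).1 <= r -> box r (G z).
Hypothesis phi_cont : continuous phi.
Hypothesis phi0 : phi 0 = 0.
Hypothesis phi_incr : forall x y : R, - r <= x -> x < y -> y <= r -> phi x < phi y.
Hypothesis phi_r : phi r < r.
Hypothesis phi_Nr : - r < phi (- r).
Hypothesis phi_iter_r : iter n phi r @[n --> \oo] --> 0.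
Hypothesis phi_iter_Nr : iter n phi (- r) @[n --> \oo] --> 0.

Let W z := G (clamp2 r z).

Let r_ge0 : 0 <= r. Proof. exact: ltW. Qed.

Let phi_r_gt0 : 0 < phi r.
Proof. by rewrite -phi0; apply: phi_incr; have := r_gt0; lra. Qed.

Let phi_Nr_lt0 : phi (- r) < 0.
Proof. by rewrite -[X in _ < X]phi0; apply: phi_incr; have := r_gt0; lra. Qed.

(* [lra] does not look at section hypotheses. *)
Ltac slra := have := r_gt0; have := phi_r; have := phi_Nr;
  have := phi_r_gt0; have := phi_Nr_lt0; lra.
Ltac snra := have := r_gt0; have := phi_r; have := phi_Nr;
  have := phi_r_gt0; have := phi_Nr_lt0; nra.

Let phi_le (x y : R) : - r <= x -> x <= y -> y <= r -> phi x <= phi y.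
Proof.
move=> rx; rewrite le_eqVlt => /orP[/eqP-> //|xy yr]; exact/ltW/phi_incr.
Qed.

(* The weight of an exit time: with u = p - r, where p is the first coordinate
   after one step of G, it interpolates between 0 at p = r and 1 at x = r. *)
Let lam (u x : R) : R := Num.max u 0 / (Num.max u 0 + (r - x)).

Let lam_le0 (u x : R) : u <= 0 -> lam u x = 0.
Proof. by move=> u0; rewrite /lam max_r// mul0r. Qed.

Let lam_gt0 (u x : R) : 0 < u -> x <= r -> 0 < lam u x.
Proof.
by move=> u0 xr; rewrite /lam (max_l (ltW u0)) divr_gt0//; slra.
Qed.

Let lam_le1 (u x : R) : 0 < u -> x <= r -> lam u x <= 1.
Proof.
move=> u0 xr; rewrite /lam (max_l (ltW u0)) ler_pdivrMr ?mul1r; slra.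
Qed.

Let lam_r (u : R) : 0 < u -> lam u r = 1.
Proof.
by move=> u0; rewrite /lam (max_l (ltW u0)) subrr addr0 divff// gt_eqF.
Qed.

Let lam_lt (u1 u2 x1 x2 : R) : 0 < u1 -> u1 < u2 -> x1 < x2 -> x2 <= r ->
  lam u1 x1 < lam u2 x2.
Proof.
move=> u10 u12 x12 x2r; have u20 := lt_trans u10 u12.
rewrite /lam (max_l (ltW u10)) (max_l (ltW u20)) ltr_pdivrMr; last by slra.
rewrite mulrAC ltr_pdivlMr; last by slra.
snra.
Qed.

(** The operator whose fixed point is the coordinate. Where [G z] stays in the box only
    [phi (A (G z))] survives. Where it leaves through the right side, the clamped point lies on that
    side, the first term is [phi r], and the second term raises it towards [r], reaching [r] on the
    side itself; the third term does the same on the left. *)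
Let step (A : R * R -> R) z : R :=
  phi (A (clamp2 r (W z)))
  + (r - phi r) * lam ((W z).1 - r) (clamp r z.1)
  - (r + phi (- r)) * lam (- (W z).1 - r) (- clamp r z.1).

(** The prescribed values on the vertical sides make the first term of [step] equal to [phi r] or
    [phi (- r)] after an exit. *)
Let admissible (A : R * R -> R) : Prop :=
  [/\ continuous A, forall z, - r <= A z <= r,
      forall z, z.1 = r -> A z = r & forall z, z.1 = - r -> A z = - r].

Let clamp1 z : - r <= clamp r z.1 <= r.
Proof. exact: clamp_bounds. Qed.

Let step_right A z : admissible A -> r < (W z).1 ->
  step A z = phi r + (r - phi r) * lam ((W z).1 - r) (clamp r z.1).
Proof.
move=> [_ _ Ar _] rp; rewrite /step Ar /=; last by rewrite clamp_ge// ltW.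
rewrite [lam (- _ - _) _]lam_le0 ?mulr0 ?subr0//; slra.
Qed.

Let step_left A z : admissible A -> (W z).1 < - r ->
  step A z = phi (- r) - (r + phi (- r)) * lam (- (W z).1 - r) (- clamp r z.1).
Proof.
move=> [_ _ _ Ar] rp; rewrite /step Ar /=; last by rewrite clamp_le// ltW.
rewrite [lam (_ - r) (clamp _ _)]lam_le0 ?mulr0 ?addr0//; slra.
Qed.

Let step_mid A z : - r <= (W z).1 <= r -> step A z = phi (A (W z)).
Proof.
move=> rp; have bW : box r (W z) by apply: G_exit => //; exact: clamp2_box.
case/andP: rp => ? ?; rewrite /step clamp2_id//.
rewrite lam_le0; last by slra.
by rewrite lam_le0 ?mulr0 ?subr0 ?addr0//; slra.
Qed.

(** The origin is fixed and in horizontal position to every point of the right side, so expansion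
    pushes that side strictly out of the box. *)
Let W_r z : z.1 = r -> r < (W z).1.
Proof.
move=> zr; have b : box r (clamp2 r z) by exact: clamp2_box.
have [||_] := @G_expands (0, 0) (clamp2 r z) _ b.
- by split=> /=; slra.
- by case: b => /= ? ? ? ?; split; rewrite /= zr (@clamp_ge _ r r)//; slra.
by rewrite G0 /= !subr0 zr (@clamp_ge _ r r).
Qed.

Let W_Nr z : z.1 = - r -> (W z).1 < - r.
Proof.
move=> zr; have b : box r (clamp2 r z) by exact: clamp2_box.
have [||_] := @G_expands (clamp2 r z) (0, 0) b.
- by split=> /=; slra.
- by case: b => /= ? ? ? ?; split; rewrite /= zr (@clamp_le _ r (- r))//; slra.
by rewrite G0 /= !sub0r zr (@clamp_le _ r (- r))// opprK ltrNr.
Qed.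

Let continuous_W1 : continuous (fun z => (W z).1).
Proof.
by move=> z; exact: (continuous_comp (@G_cont z) (@continuous_fst _ _)).
Qed.

Let continuous_clamp1 : continuous (fun z : R * R => clamp r z.1).
Proof.
by move=> z; exact: (continuous_comp (@continuous_fst _ z) (@continuous_clamp _ r _)).
Qed.

(** The denominator of [lam] vanishes only where [g z = r] and [f z <= 0], which the last hypothesis
    excludes. *)
Let continuous_lam (f g : R * R -> R) : continuous f -> continuous g ->
  (forall z, g z <= r) -> (forall z, g z = r -> 0 < f z) ->
  continuous (fun z => lam (f z) (g z)).
Proof.
move=> cf cg gr fg z.
have cm : {for z, continuous (fun z => Num.max (f z) 0)}.
  by apply: (@continuous_max R _ f (cst 0)); [exact: cf|exact: cvg_cst].
apply: cvgM; first exact: cm.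
apply: cvgV; last first.
  apply: cvgD; first exact: cm.
  by apply: cvgB; [exact: cvg_cst|exact: cg].
have m0 : 0 <= Num.max (f z) 0 by rewrite le_max lexx orbT.
have [gz|gz] := eqVneq (g z) r.
  by have := fg _ gz => f0; rewrite max_l ?ltW//; apply: lt0r_neq0; slra.
by have := gr z; rewrite le_eqVlt (negbTE gz)/= => ?; apply: lt0r_neq0; slra.
Qed.

(** Values lie between [phi r] and [r] after an exit to the right, between [- r] and [phi (- r)]
    after an exit to the left, and between [phi (- r)] and [phi r] otherwise. Continuity needs no
    case split, since [step] is a single formula. *)
Let step_admissible A : admissible A -> admissible (step A).
Proof.
move=> admA; have [cA bA Ar ANr] := admA; split.
- move=> z; apply: cvgB; [apply: cvgD|].
  + apply: (continuous_comp _ (@phi_cont _)).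
    apply: (continuous_comp _ (@cA _)).
    exact: (continuous_comp (@G_cont z) (@continuous_clamp2 _ r _)).
  + apply: cvgM; first exact: cvg_cst.
    apply: continuous_lam => //.
    * by move=> y; apply: cvgB; [exact: continuous_W1|exact: cvg_cst].
    * by move=> y; case/andP: (clamp1 y).
    * move=> y yr; rewrite subr_gt0.
      have <- : W (clamp2 r y) = W y by rewrite /W clamp2_id//; exact: clamp2_box.
      exact: W_r.
  + apply: cvgM; first exact: cvg_cst.
    apply: continuous_lam => //.
    * move=> y; apply: cvgB; last exact: cvg_cst.
      by apply: cvgN; exact: continuous_W1.
    * by move=> y; apply: cvgN; exact: continuous_clamp1.
    * by move=> y; case/andP: (clamp1 y) => ? ?; slra.
    * move=> y yr; have yr' : (clamp2 r y).1 = - r by rewrite /=; slra.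
      have <- : W (clamp2 r y) = W y by rewrite /W clamp2_id//; exact: clamp2_box.
      by have := W_Nr yr'; slra.
- move=> z; have [rp|pr] := ltP r (W z).1.
    rewrite step_right//; have /andP[? ?] := clamp1 z.
    set l := lam _ _.
    have l0 : 0 < l by apply: lam_gt0 => //; slra.
    have l1 : l <= 1 by apply: lam_le1 => //; slra.
    by apply/andP; split; snra.
  have [rp|rp] := ltP (W z).1 (- r).
    rewrite step_left//; have /andP[? ?] := clamp1 z.
    set l := lam _ _.
    have l0 : 0 < l by apply: lam_gt0 => //; slra.
    have l1 : l <= 1 by apply: lam_le1 => //; slra.
    by apply/andP; split; snra.
  rewrite step_mid ?rp//; have /andP[? ?] := bA (W z).
  have := @phi_le (- r) (A (W z)); have := @phi_le (A (W z)) r => h1 h2.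
  by apply/andP; split; [apply: le_trans (h2 _ _ _)|apply: le_trans (h1 _ _ _) _];
    slra.
- move=> z zr; have rp := W_r zr; rewrite step_right// zr clamp_ge// lam_r; slra.
- move=> z zr; have rp := W_Nr zr; rewrite step_left// zr clamp_le// opprK lam_r; slra.
Qed.

Let approx n : R * R -> R := iter n step (fun z => clamp r z.1).

Let approx_admissible n : admissible (approx n).
Proof.
elim: n => [|n IH]; last exact: step_admissible.
split=> //.
- by move=> z /= ->; rewrite clamp_ge.
- by move=> z /= ->; rewrite clamp_le.
Qed.

(** An orbit that leaves within [n] steps has its value fixed at the exit, whatever function the
    iteration started from. Otherwise both values lie in the image of the interval under [n]
    iterates of [phi]. *)
Let approx_dichotomy (n m : nat) z : approx (n + m) z = approx n z \/
  (iter n phi (- r) <= approx n z <= iter n phi r /\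
   iter n phi (- r) <= approx (n + m) z <= iter n phi r).
Proof.
elim: n z => [|n IH] z.
  right; split; first by have [_ ->] := approx_admissible 0.
  by have [_ ->] := approx_admissible (0 + m).
rewrite addSn; change (step (approx (n + m)) z = step (approx n) z \/
  (iter n.+1 phi (- r) <= step (approx n) z <= iter n.+1 phi r /\
   iter n.+1 phi (- r) <= step (approx (n + m)) z <= iter n.+1 phi r)).
have [rp|pr] := ltP r (W z).1; first by left; rewrite !step_right.
have [rp|rp] := ltP (W z).1 (- r); first by left; rewrite !step_left.
rewrite !step_mid ?rp//; have [->|[h1 h2]] := IH (W z); first by left.
right; rewrite !iterS.
have it k : - r <= iter k phi (- r) <= 0 /\ 0 <= iter k phi r <= r.
  elim: k => [|k [/andP[k1 k2] /andP[k3 k4]]];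
    first by split; apply/andP; split=> /=; slra.
  have e1 : phi (iter k phi (- r)) <= phi 0 by apply: phi_le; slra.
  have e2 : phi 0 <= phi (iter k phi r) by apply: phi_le; slra.
  have e3 : phi (- r) <= phi (iter k phi (- r)) by apply: phi_le; slra.
  have e4 : phi (iter k phi r) <= phi r by apply: phi_le; slra.
  by move: e1 e2; rewrite phi0 !iterS => e1 e2; split; apply/andP; split; slra.
have [/andP[? ?] /andP[? ?]] := it n; case/andP: h1 => ? ?; case/andP: h2 => ? ?.
by split; apply/andP; split; apply: phi_le; slra.
Qed.

(** Length of the image of the interval under [iter n phi]. It bounds the distance from [approx n]
    to all later approximations uniformly in the point, so the limit is continuous. *)
Let gap n : R := `|iter n phi r - iter n phi (- r)|.

Let gap_small (e : R) : 0 < e -> exists n, gap n < e.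
Proof.
move=> e0.
have h : (iter n phi r - iter n phi (- r)) @[n --> \oo] --> 0.
  by rewrite -[X in _ --> X](subrr 0); apply: cvgB.
have /cvgrPdist_lt/(_ _ e0)[n _ /(_ n (leqnn n)) /=] := h.
by rewrite sub0r normrN => ?; exists n.
Qed.

Let approx_close n m z : `|approx (n + m) z - approx n z| <= gap n.
Proof.
have [->|[/andP[a b] /andP[c d]]] := approx_dichotomy n m z.
  by rewrite subrr normr0 normr_ge0.
apply: le_trans (ler_norm _); rewrite ler_norml; apply/andP; split; lra.
Qed.

Let fiber z : R := lim (approx n z @[n --> \oo]).

Let approx_cvg z : approx n z @[n --> \oo] --> fiber z.
Proof.
apply: cauchy_cvg; apply: cauchy_exP => e e0.
have [n ne] := gap_small e0; exists (approx n z); exists n => // m /= nm.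
rewrite /ball /= distrC -(subnKC nm); apply: le_lt_trans ne.
exact: approx_close.
Qed.

Let fiber_close n z : `|fiber z - approx n z| <= gap n.
Proof.
apply/ler_addgt0Pr => e e0; have e0' : (0 : R) < e := e0.
have /cvgrPdist_lt/(_ _ e0')[m _ /(_ (n + m)%N (leq_addl n m)) /= he] :=
  @approx_cvg z.
rewrite -(subrK (approx (n + m) z) (fiber z)) -addrA (le_trans (ler_normD _ _))//.
by rewrite [leRHS]addrC; apply: lerD; [exact: ltW|exact: approx_close].
Qed.

Let fiber_continuous : continuous fiber.
Proof.
move=> z; apply/cvgrPdist_lt => e e0.
have e3 : 0 < e / 3%:R by rewrite divr_gt0.
have [n ne] := gap_small e3.
have [cn _ _ _] := approx_admissible n.
have /cvgrPdist_lt/(_ _ e3) := cn z; apply: filterS => y yz.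
have zc := fiber_close n z; have yc := fiber_close n y.
rewrite (_ : fiber z - fiber y = (fiber z - approx n z) +
   (approx n z - approx n y) - (fiber y - approx n y)); last by ring.
apply: le_lt_trans (ler_normB _ _) _.
have := ler_normD (fiber z - approx n z) (approx n z - approx n y).
move: zc yc ne yz; rewrite /=; lra.
Qed.

Let fiber_bounds z : - r <= fiber z <= r.
Proof.
apply/andP; split.
  apply: limr_ge; first by apply/cvg_ex; exists (fiber z); exact: approx_cvg.
  by near=> n; have [_ /(_ z)/andP[]] := approx_admissible n.
apply: limr_le; first by apply/cvg_ex; exists (fiber z); exact: approx_cvg.
by near=> n; have [_ /(_ z)/andP[]] := approx_admissible n.
Unshelve. all: by end_near. Qed.

(** At a given point [step A] reads [A] at one point only, so pointwise convergence is enough to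
    pass to the limit. *)
Let fiber_eq z : fiber z = step fiber z.
Proof.
have h : step (approx n) z @[n --> \oo] --> step fiber z.
  apply: cvgB; last exact: cvg_cst.
  apply: cvgD; last exact: cvg_cst.
  apply: (cvg_comp (fun n => approx n (clamp2 r (W z))) phi).
    exact: approx_cvg.
  exact: phi_cont.
have h' : approx n z @[n --> \oo] --> step fiber z.
  by rewrite -(cvg_shiftS (fun n => approx n z)).
exact: (cvg_unique (@norm_hausdorff _ _) (@approx_cvg z) h').
Qed.

Let fiber_admissible : admissible fiber.
Proof.
split=> // z zr.
  apply: (cvg_unique (@norm_hausdorff _ _) (@approx_cvg z)).
  rewrite (_ : (fun n => _) = cst r); first exact: cvg_cst.
  by apply/funext => n; have [_ _ ->] := approx_admissible n.
apply: (cvg_unique (@norm_hausdorff _ _) (@approx_cvg z)).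
rewrite (_ : (fun n => _) = cst (- r)); first exact: cvg_cst.
by apply/funext => n; have [_ _ _ ->] := approx_admissible n.
Qed.

Let W_box z : box r z -> W z = G z.
Proof. by move=> bz; rewrite /W clamp2_id. Qed.

Let fiber_semiconj z : box r z -> box r (G z) -> fiber z = phi (fiber (G z)).
Proof.
by move=> bz [? ? _ _]; rewrite fiber_eq step_mid W_box//; apply/andP.
Qed.

(** If one of the two points leaves the box, the values are strictly ordered: a right exit gives
    more than [phi r], a left exit less than [phi (- r)], and two exits on the same side are
    compared by [lam_lt]. So a pair violating the order stays inside, and [phi] being increasing
    passes the violation on to the images. *)
Let fiber_le_step z1 z2 : box r z1 -> box r z2 -> hcone z1 z2 ->
  fiber z2 <= fiber z1 ->
  [/\ box r (G z1), box r (G z2) & fiber (G z2) <= fiber (G z1)].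
Proof.
move=> b1 b2 h; have [[p12 _ _] _] := G_expands b1 b2 h.
have [x12 _ _] := h; have [b11 b12 _ _] := b1; have [b21 b22 _ _] := b2.
have c1 : clamp r z1.1 = z1.1 by rewrite clamp_id//; apply/andP.
have c2 : clamp r z2.1 = z2.1 by rewrite clamp_id//; apply/andP.
have pf z : phi (- r) <= phi (fiber z) <= phi r.
  have /andP[? ?] := fiber_bounds z.
  by apply/andP; split; apply: phi_le; slra.
rewrite (fiber_eq z1) (fiber_eq z2).
have [rp2|p2r] := ltP r (W z2).1.
  rewrite (step_right fiber_admissible rp2) c2.
  have l2 : 0 < lam ((W z2).1 - r) z2.1 by apply: lam_gt0 => //; slra.
  have t2 : 0 < (r - phi r) * lam ((W z2).1 - r) z2.1.
    by rewrite mulr_gt0//; slra.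
  have [rp1|p1r] := ltP r (W z1).1.
    rewrite (step_right fiber_admissible rp1) c1 lerD2l ler_pM2l; last by slra.
    have lt_lam : lam ((W z1).1 - r) z1.1 < lam ((W z2).1 - r) z2.1.
      by apply: lam_lt => //; rewrite ?W_box//; move: rp1; rewrite ?W_box//; lra.
    by rewrite leNgt lt_lam.
  have [rp1|rp1] := ltP (W z1).1 (- r).
    rewrite (step_left fiber_admissible rp1) c1.
    have l1 : 0 < lam (- (W z1).1 - r) (- z1.1) by apply: lam_gt0 => //; slra.
    have t1 : 0 < (r + phi (- r)) * lam (- (W z1).1 - r) (- z1.1).
      by rewrite mulr_gt0//; slra.
    by slra.
  rewrite step_mid ?rp1//; have /andP[_] := pf (W z1); lra.
have [rp1|rp1] := ltP (W z1).1 (- r).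
  rewrite (step_left fiber_admissible rp1) c1.
  have l1 : 0 < lam (- (W z1).1 - r) (- z1.1) by apply: lam_gt0 => //; slra.
  have t1 : 0 < (r + phi (- r)) * lam (- (W z1).1 - r) (- z1.1).
    by rewrite mulr_gt0//; slra.
  have [rp2|rp2] := ltP (W z2).1 (- r).
    rewrite (step_left fiber_admissible rp2) c2 lerD2l lerN2 ler_pM2l; last by slra.
    have lt_lam : lam (- (W z2).1 - r) (- z2.1) < lam (- (W z1).1 - r) (- z1.1).
      by apply: lam_lt => //; move: rp2; rewrite ?W_box//; lra.
    by rewrite leNgt lt_lam.
  rewrite step_mid ?rp2//; have /andP[+ _] := pf (W z2); lra.
have q1 : - r <= (W z1).1 <= r.
  by rewrite rp1 /=; move: p12 p2r; rewrite !W_box//; lra.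
have q2 : - r <= (W z2).1 <= r.
  by rewrite p2r andbT; move: rp1 p12; rewrite !W_box//; lra.
rewrite !step_mid// !W_box// => le_phi.
have bG1 : box r (G z1) by apply: G_exit; rewrite // -W_box.
have bG2 : box r (G z2) by apply: G_exit; rewrite // -W_box.
split=> //; rewrite leNgt; apply/negP => lt_fib.
have /andP[f1 _] := fiber_bounds (G z1); have /andP[_ f2] := fiber_bounds (G z2).
by have := phi_incr f1 lt_fib f2; rewrite ltNge le_phi.
Qed.

(* A pair on which the coordinate fails to increase never leaves the box, so
   its horizontal separation would grow by a definite amount at each step. *)
Let fiber_incr z1 z2 : box r z1 -> box r z2 -> hcone z1 z2 ->
  fiber z1 < fiber z2.
Proof.
move=> b1 b2 h; rewrite ltNge; apply/negP => le12.
pose d := z2.1 - z1.1.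
have d0 : 0 < d by case: h; rewrite subr_gt0.
(* Closed conditions only: a separation of at least [d] replaces the strict inequality of [hcone].
   Hence [K] is compact and [gain], positive on it, is bounded away from 0. *)
pose K : set ((R * R) * (R * R)) := [set p | [/\ box r p.1, box r p.2,
  0 <= p.2.1 - p.1.1 - d, 0 <= (p.2.1 - p.1.1) - (p.2.2 - p.1.2) &
  0 <= (p.2.1 - p.1.1) - (p.1.2 - p.2.2)]].
pose gain (p : (R * R) * (R * R)) : R :=
  ((W p.2).1 - (W p.1).1) - (p.2.1 - p.1.1).
have c11 : continuous (fun p : (R * R) * (R * R) => p.1.1).
  by move=> p; apply: (cvg_comp fst fst); exact: cvg_fst.
have c12 : continuous (fun p : (R * R) * (R * R) => p.1.2).
  by move=> p; apply: (cvg_comp fst snd); [exact: cvg_fst|exact: cvg_snd].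
have c21 : continuous (fun p : (R * R) * (R * R) => p.2.1).
  by move=> p; apply: (cvg_comp snd fst); [exact: cvg_snd|exact: cvg_fst].
have c22 : continuous (fun p : (R * R) * (R * R) => p.2.2).
  by move=> p; apply: (cvg_comp snd snd); exact: cvg_snd.
have cW1 : continuous (fun p : (R * R) * (R * R) => (W p.1).1).
  by move=> p; apply: (cvg_comp fst (fun z => (W z).1));
    [exact: cvg_fst|exact: continuous_W1].
have cW2 : continuous (fun p : (R * R) * (R * R) => (W p.2).1).
  by move=> p; apply: (cvg_comp snd (fun z => (W z).1));
    [exact: cvg_snd|exact: continuous_W1].
have cB (f g : (R * R) * (R * R) -> R) : continuous f -> continuous g ->
    continuous (fun p => f p - g p).
  by move=> cf cg p; apply: cvgB; [exact: cf|exact: cg].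
have cgain : continuous gain by exact: cB (cB _ _ cW2 cW1) (cB _ _ c21 c11).
have cK : compact K.
  have ge0_closed (f : (R * R) * (R * R) -> R) : continuous f ->
      closed [set p | 0 <= f p].
    by move=> cf; apply: (@closed_comp _ _ f [set x | 0 <= x]) => // p _; exact: cf.
  apply: (@subclosed_compact _ _ (box r `*` box r)).
  - rewrite (_ : K = (box r `*` box r) `&` [set p | 0 <= p.2.1 - p.1.1 - d] `&`
      [set p | 0 <= (p.2.1 - p.1.1) - (p.2.2 - p.1.2)] `&`
      [set p | 0 <= (p.2.1 - p.1.1) - (p.1.2 - p.2.2)]); last first.
      by apply/seteqP; split=> p /=; [case=> *|case=> -[[[]]]] => *; split=> //; split.
    apply: closedI; [apply: closedI; [apply: closedI|]|].
    + apply: compact_closed; last by apply: compact_setX; exact: box_compact.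
      exact: norm_hausdorff.
    + apply: ge0_closed; apply: (cB _ (cst d)); first exact: cB c21 c11.
      by move=> p; exact: cvg_cst.
    + by apply: ge0_closed; exact: cB (cB _ _ c21 c11) (cB _ _ c22 c12).
    + by apply: ge0_closed; exact: cB (cB _ _ c21 c11) (cB _ _ c12 c22).
  - by apply: compact_setX; exact: box_compact.
  - by move=> p [].
have [e e0 gain_e] : exists2 e : R, 0 < e & forall p, K p -> e <= gain p.
  apply: positive_lower_bound => //; first exact: continuous_subspaceT.
  move=> [p q] [/= bp bq h0 h1 h2]; rewrite /gain /= !W_box// subr_gt0.
  by have [|_ ] := G_expands bp bq; first by split; lra.
have orbit n : exists w1 w2, [/\ box r w1, box r w2, hcone w1 w2,
    fiber w2 <= fiber w1 & d + e *+ n <= w2.1 - w1.1].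
  elim: n => [|n [w1 [w2 [bw1 bw2 hw lew dw]]]].
    by exists z1, z2; rewrite mulr0n addr0.
  exists (G w1), (G w2).
  have [bG1 bG2 leG] := fiber_le_step bw1 bw2 hw lew.
  have [hG _] := G_expands bw1 bw2 hw; split=> //.
  have en : 0 <= e *+ n by rewrite mulrn_wge0// ltW.
  have : e <= gain (w1, w2).
    by apply: gain_e; split=> //=; case: hw; lra.
  rewrite /gain /= !W_box// mulrS; lra.
(* The box has width [2 * r], which a separation of [d + e *+ n] would exceed. *)
have [n _ ne] : exists2 n : nat, True & 2 * r < e *+ n.
  exists (Num.truncn (2 * r / e)).+1 => //.
  by rewrite -[e *+ _]mulr_natl -ltr_pdivrMr// truncnS_gt.
have [w1 [w2 [[? ? _ _] [? ? _ _] _ _]]] := orbit n.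
move: d0 ne; slra.
Qed.

Lemma fiber_coordinate : exists A : R * R -> R,
  [/\ continuous A, forall z, - r <= A z <= r, A (0, 0) = 0,
      forall z1 z2, box r z1 -> box r z2 -> hcone z1 z2 -> A z1 < A z2 &
      forall z, box r z -> box r (G z) -> A z = phi (A (G z))].
Proof.
exists fiber; split=> //.
have b0 : box r (0, 0) by split=> /=; slra.
(* The value at the origin is a fixed point of [phi], hence squeezed between the orbits of [- r] and
   [r], which tend to 0. *)
have e0 : fiber (0, 0) = phi (fiber (0, 0)) by rewrite -[in RHS]G0 -fiber_semiconj ?G0.
have /andP[f1 f2] := fiber_bounds (0, 0).
have it n : [/\ - r <= iter n phi (- r), iter n phi (- r) <= fiber (0, 0),
    fiber (0, 0) <= iter n phi r & iter n phi r <= r].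
  elim: n => [|n [i1 i2 i3 i4]]; first by split.
  rewrite !iterS e0; split.
  - by apply: le_trans (ltW phi_Nr) _; apply: phi_le => //; slra.
  - by apply: phi_le.
  - by apply: phi_le.
  - by apply: le_trans (ltW phi_r); apply: phi_le => //; slra.
apply/eqP; rewrite eq_le; apply/andP; split.
  rewrite -[leRHS](cvg_lim (@norm_hausdorff _ _) phi_iter_r).
  apply: limr_ge; first by apply/cvg_ex; exists 0.
  by apply: nearW => n; have [] := it n.
rewrite -[leLHS](cvg_lim (@norm_hausdorff _ _) phi_iter_Nr).
apply: limr_le; first by apply/cvg_ex; exists 0.
by apply: nearW => n; have [] := it n.
Qed.

End FiberCoordinate.

(** * Conjugacy on a box *)

Section BoxConjugacy.
Context {R : realType}.
Implicit Types (z w : R * R) (r : R).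

(** Contraction in the topological sense: orbits tend to 0, but no Lipschitz constant below 1 is
    required. *)
Definition interval_contraction r (phi : R -> R) : Prop :=
  [/\ {within [set x | - r <= x <= r], continuous phi}, phi 0 = 0,
      forall x y : R, - r <= x -> x < y -> y <= r -> phi x < phi y,
      phi r < r /\ - r < phi (- r) &
      forall x, - r <= x <= r -> iter n phi x @[n --> \oo] --> 0].

(** Replacing [phi] by [phi \o clamp r] makes it continuous everywhere and changes neither its
    values nor its orbits on the interval. *)
Lemma box_fiber_coordinate r (G : R * R -> R * R) (phi : R -> R) :
  0 < r -> {within box r, continuous G} -> G (0, 0) = (0, 0) ->
  (forall z1 z2, box r z1 -> box r z2 -> hcone z1 z2 ->
    hcone (G z1) (G z2) /\ z2.1 - z1.1 < (G z2).1 - (G z1).1) ->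
  (forall z, box r z -> - r <= (G z).1 <= r -> box r (G z)) ->
  interval_contraction r phi ->
  exists A : R * R -> R,
  [/\ continuous A, forall z, - r <= A z <= r, A (0, 0) = 0,
      forall z1 z2, box r z1 -> box r z2 -> hcone z1 z2 -> A z1 < A z2 &
      forall z, box r z -> box r (G z) -> A z = phi (A (G z))].
Proof.
move=> r0 cG G0 Gexp Gexit [cphi phi0 phi_incr [phir phiNr] phi_iter].
pose psi := phi \o clamp r.
have psiE x : - r <= x <= r -> psi x = phi x.
  by move=> xr; rewrite /psi /= clamp_id.
have rr : - r <= r <= r by apply/andP; split; lra.
have rNr : - r <= - r <= r by apply/andP; split; lra.
have r00 : - r <= 0 <= r by apply/andP; split; lra.
have phi_maps x : - r <= x <= r -> - r <= phi x <= r.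
  move=> /andP[x1 x2]; apply/andP; split.
    have [->|xr] := eqVneq x (- r); first exact: ltW.
    apply/ltW/(lt_trans phiNr)/phi_incr => //.
    by rewrite lt_neqAle eq_sym xr.
  have [->|xr] := eqVneq x r; first exact: ltW.
  by apply/ltW; apply: lt_trans phir; apply: phi_incr => //; rewrite lt_neqAle xr.
have psi_iter n x : - r <= x <= r ->
    iter n psi x = iter n phi x /\ - r <= iter n phi x <= r.
  move=> xr; elim: n => [|n [IH b]]; first by split.
  by rewrite !iterS IH psiE//; split=> //; exact: phi_maps.
have psi_cvg x : - r <= x <= r -> iter n psi x @[n --> \oo] --> 0.
  move=> xr; rewrite (_ : (fun n => _) = (fun n => iter n phi x)); last first.
    by apply/funext => n; have [] := psi_iter n x xr.
  exact: phi_iter.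
have [A [cA bA A0 Aincr AG]] : exists A : R * R -> R,
  [/\ continuous A, forall z, - r <= A z <= r, A (0, 0) = 0,
      forall z1 z2, box r z1 -> box r z2 -> hcone z1 z2 -> A z1 < A z2 &
      forall z, box r z -> box r (G z) -> A z = psi (A (G z))].
  apply: fiber_coordinate => //.
  - have r0' := ltW r0.
    apply: (continuous_comp_within (fun z => clamp2_box z r0')) => //.
    exact: continuous_clamp2.
  - have r0' := ltW r0.
    apply: (@continuous_comp_within _ _ _ [set x : R | - r <= x <= r]) => //.
      by move=> x; exact: clamp_bounds.
    exact: continuous_clamp.
  - by rewrite psiE.
  - move=> x y rx xy yr.
    by rewrite !psiE; [exact: phi_incr| apply/andP; split; lra..].
  - by rewrite psiE.
  - by rewrite psiE.
  - exact: psi_cvg.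
  - exact: psi_cvg.
by exists A; split=> // z bz bGz; rewrite AG// psiE.
Qed.

Definition swap z : R * R := (z.2, z.1).

(** Defined through [swap], so that results on horizontal pairs apply to a map with its axes
    exchanged. *)
Definition vcone z w : Prop := hcone (swap z) (swap w).

Lemma continuous_swap : continuous swap.
Proof. apply: continuous_pair; [exact: continuous_snd|exact: continuous_fst]. Qed.

Lemma box_swap r z : box r z -> box r (swap z).
Proof. by case. Qed.

Lemma cone_cover z w : z <> w ->
  hcone z w \/ hcone w z \/ vcone z w \/ vcone w z.
Proof.
case: z w => [x1 y1] [x2 y2] zw; rewrite /vcone /hcone /=.
have {}zw : x1 = x2 -> y1 = y2 -> False by move=> ? ?; apply: zw; congr pair.
have [x12|x21|x12] := ltgtP x1 x2; have [y12|y21|y12] := ltgtP y1 y2.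
- have [le|lt] := leP (y2 - y1) (x2 - x1); [left|right; right; left]; split=> //; lra.
- have [le|lt] := leP (y1 - y2) (x2 - x1); [left|right; right; right]; split=> //; lra.
- left; split=> //; lra.
- have [le|lt] := leP (y2 - y1) (x1 - x2);
    [right; left|right; right; left]; split=> //; lra.
- have [le|lt] := leP (y1 - y2) (x1 - x2);
    [right; left|right; right; right]; split=> //; lra.
- right; left; split=> //; lra.
- right; right; left; split=> //; lra.
- right; right; right; split=> //; lra.
- by case: zw.
Qed.

(** A level set of a function increasing along horizontal pairs contains no such pair; this bound
    then makes it a 1-Lipschitz graph over the second coordinate. *)
Lemma not_hcone_dist z w : z.1 < w.1 -> ~ hcone z w -> `|z.1 - w.1| <= `|z.2 - w.2|.
Proof.
move=> zw nh; rewrite leNgt; apply/negP.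
rewrite [`|z.1 - _|]distrC [`|w.1 - _|]gtr0_norm ?subr_gt0// => lt.
have := ler_norm (z.2 - w.2); have := ler_norm (w.2 - z.2).
by rewrite (distrC w.2) => ? ?; apply: nh; split=> //; lra.
Qed.

Lemma level_surjective (r : R) (A B : R * R -> R) :
  0 < r -> continuous A -> continuous B -> A (0, 0) = 0 -> B (0, 0) = 0 ->
  (forall z1 z2, box r z1 -> box r z2 -> hcone z1 z2 -> A z1 < A z2) ->
  (forall z1 z2, box r z1 -> box r z2 -> vcone z1 z2 -> B z1 < B z2) ->
  nbhs ((0, 0) : R * R) [set (A z, B z) | z in box r].
Proof.
move=> r0 cA cB A0 B0 Ainc Binc.
have cl (x y : R) : continuous (fun t : R => (x, t)).
  by apply: continuous_pair => t; [exact: cvg_cst|exact: cvg_id].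
have cr (x y : R) : continuous (fun t : R => (t, y)).
  by apply: continuous_pair => t; [exact: cvg_id|exact: cvg_cst].
have edge (f : R -> R) : continuous f -> (forall t, - r <= t <= r -> 0 < f t) ->
    exists2 e : R, 0 < e & forall t, - r <= t <= r -> e <= f t.
  move=> cf f0; have [e e0 ef] : exists2 e : R, 0 < e &
      forall t, `[- r, r]%classic t -> e <= f t.
    apply: positive_lower_bound; first exact: segment_compact.
      exact: continuous_subspaceT.
    by move=> t; rewrite /= in_itv/=; exact: f0.
  by exists e => // t tr; apply: ef; rewrite /= in_itv.
have b0 : box r (0, 0) by split=> /=; lra.
(* Each point of a side is in horizontal or vertical position to the origin, where [A] and [B]
   vanish. So [A] and [B] have a strict sign on the sides, and by compactness they stay away from 0
   there. *)
have [a1 a10 Ha1] : exists2 e : R, 0 < e & forall t, - r <= t <= r -> e <= A (r, t).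
  apply: edge; first by move=> t; apply: continuous_comp; [exact: cl|exact: cA].
  by move=> t /andP[? ?]; rewrite -A0; apply: Ainc => //; split=> /=; lra.
have [a2 a20 Ha2] : exists2 e : R, 0 < e & forall t, - r <= t <= r -> e <= - A (- r, t).
  apply: edge; first by move=> t; apply: cvgN;
    apply: continuous_comp; [exact: cl|exact: cA].
  move=> t /andP[? ?]; rewrite oppr_gt0 -[ltRHS]A0; apply: Ainc => //; split=> /=; lra.
have [b1 b10 Hb1] : exists2 e : R, 0 < e & forall t, - r <= t <= r -> e <= B (t, r).
  apply: edge; first by move=> t; apply: continuous_comp; [exact: cr|exact: cB].
  by move=> t /andP[? ?]; rewrite -B0; apply: Binc => //; split=> /=; lra.
have [b2 b20 Hb2] : exists2 e : R, 0 < e & forall t, - r <= t <= r -> e <= - B (t, - r).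
  apply: edge; first by move=> t; apply: cvgN;
    apply: continuous_comp; [exact: cr|exact: cB].
  move=> t /andP[? ?]; rewrite oppr_gt0 -[ltRHS]B0; apply: Binc => //; split=> /=; lra.
suff H (s t : R) : - a2 <= s <= a1 -> - b2 <= t <= b1 ->
    exists2 z, box r z & (A z, B z) = (s, t).
  pose m := Num.min (Num.min a1 a2) (Num.min b1 b2).
  have m0 : 0 < m by rewrite !lt_min a10 a20 b10 b20.
  apply/nbhs_ballP; exists m => //= -[s t] [/=].
  rewrite /ball /= !sub0r !normrN !lt_min.
  move=> /andP[/andP[s1 s2] _] /andP[_ /andP[t1 t2]].
  have [||z bz zE] := H s t; last by exists z.
  by move: s1 s2; rewrite !ltr_norml => /andP[_ ?] /andP[? _];
      apply/andP; split; exact: ltW.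
  by move: t1 t2; rewrite !ltr_norml => /andP[_ ?] /andP[? _];
      apply/andP; split; exact: ltW.
move=> /andP[s1 s2] /andP[t1 t2].
(* [u y] is the abscissa of the point of level [s] on the line at height [y]. The value 0 outside
   the interval is a default that makes [choice] applicable. *)
have Hu (y : R) : exists x : R, - r <= y <= r -> - r <= x <= r /\ A (x, y) = s.
  have [yr|nyr] := boolP (- r <= y <= r); last by exists 0.
  have [|||x] := @IVT R (fun x => A (x, y)) (- r) r s.
  - lra.
  - apply: continuous_subspaceT => x.
    by apply: continuous_comp; [exact: cr|exact: cA].
  - have := Ha1 _ yr; have := Ha2 _ yr => ? ?.
    by rewrite ge_min le_max; apply/andP; split; apply/orP; [left|right]; lra.
  by rewrite in_itv /= => xr xs; exists x.
have [u uP] := choice Hu.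
have u_lip (y1 y2 : R) : - r <= y1 <= r -> - r <= y2 <= r ->
    `|u y1 - u y2| <= `|y1 - y2|.
  move=> r1 r2; have [/andP[u11 u12] uE1] := uP _ r1.
  have [/andP[u21 u22] uE2] := uP _ r2.
  case/andP: r1 => r11 r12; case/andP: r2 => r21 r22.
  have q1 : box r (u y1, y1) by split.
  have q2 : box r (u y2, y2) by split.
  have [lt|lt|->] := ltgtP (u y1) (u y2); last by rewrite subrr normr0.
    apply: (@not_hcone_dist (u y1, y1) (u y2, y2)) => //.
    by move/(Ainc _ _ q1 q2); rewrite uE1 uE2 ltxx.
  rewrite distrC [leRHS]distrC; apply: (@not_hcone_dist (u y2, y2) (u y1, y1)) => //.
  by move/(Ainc _ _ q2 q1); rewrite uE1 uE2 ltxx.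
have cu : {within `[- r, r]%classic, continuous u}.
  apply/subspace_continuousP => y /=; rewrite in_itv/= => yr.
  apply/cvgrPdist_lt => e e0; near=> y'.
  apply: (@le_lt_trans _ _ `|y - y'|).
    by apply: u_lip => //; near: y'; exact: withinT.
  near: y'; apply: cvg_within.
  by have /cvgrPdist_lt/(_ _ e0) := @cvg_id _ (nbhs y).
(* Along the level curve [A = s] only [B] varies, and it is at most [- b2] at the bottom and at
   least [b1] at the top. *)
have cw : {within `[- r, r]%classic, continuous (fun y => B (u y, y))}.
  apply: (@within_continuous_comp _ _ _ _ (fun y => (u y, y)) B).
    by move=> z _; exact: cB.
  apply/subspace_continuousP => y yr.
  have hu : u @ within `[- r, r]%classic (nbhs y) --> u y.
    by move/subspace_continuousP : cu; exact.
  have hi : id @ within `[- r, r]%classic (nbhs y) --> y by exact: cvg_within.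
  exact: (cvg_pair hu hi).
have [||y] := @IVT R (fun y => B (u y, y)) (- r) r t _ cw.
- lra.
- have rr : - r <= r <= r by apply/andP; split; lra.
  have rNr : - r <= - r <= r by apply/andP; split; lra.
  have [/Hb1 ? _] := uP _ rr; have [/Hb2 ? _] := uP _ rNr.
  by rewrite ge_min le_max; apply/andP; split; apply/orP; [left|right]; lra.
rewrite in_itv/= => yr yt; have [ur us] := uP _ yr.
exists (u y, y); last by rewrite us yt.
by case/andP: yr; case/andP: ur.
Unshelve. all: by end_near. Qed.

(** On the points of [K] at distance at least [e] from [z], the distance from [h w] to [h z] has a
    positive lower bound by compactness and injectivity. This bound serves as the delta for
    continuity of the inverse at [h z]. *)
Lemma compact_homeomorphism (K : set (R * R)) (h : R * R -> R * R) :
  compact K -> continuous h ->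
  (forall z w, K z -> K w -> h z = h w -> z = w) ->
  homeomorphism K (h @` K) h.
Proof.
move=> cK ch hinj.
have [k kP] : exists k : R * R -> R * R, forall z, K z -> k (h z) = z.
  have H w : exists z, forall y, K y -> h y = w -> z = y.
    have [[z Kz zw]|nz] := pselect (exists2 z, K z & h z = w).
      by exists z => y Ky yw; apply: hinj => //; rewrite zw yw.
    by exists (0, 0) => y Ky yw; case: nz; exists y.
  have [k kP] := choice H; exists k => z Kz; exact: kP.
split.
- by split=> // z w /set_mem Kz /set_mem Kw; exact: hinj.
- exact: continuous_subspaceT.
exists k; split=> //; apply/subspace_continuousP => _ [z Kz <-].
rewrite /from_subspace /= kP//.
apply/cvgrPdist_lt => e e0.
pose L := K `&` [set w | e <= `|z - w|].
have cL : compact L.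
  apply: compact_closedI => //.
  apply: (@closed_comp _ _ (fun w => `|z - w|) [set x : R | e <= x]) => //.
  by move=> w _; apply: cvg_norm; apply: cvgB; [exact: cvg_cst|exact: cvg_id].
have [d d0 Ld] : exists2 d : R, 0 < d & forall w, L w -> d <= `|h z - h w|.
  apply: positive_lower_bound => //.
    apply: continuous_subspaceT => w.
    by apply: cvg_norm; apply: cvgB; [exact: cvg_cst|exact: ch].
  move=> w [Kw ew]; rewrite normr_gt0 subr_eq0; apply/eqP => hzw.
  by move: ew; rewrite /= (hinj _ _ Kz Kw hzw) subrr normr0 leNgt e0.
near=> y.
have [w Kw wy] : (h @` K) y by near: y; exact: withinT.
have dy : `|h z - y| < d.
  near: y; apply: cvg_within.
  by have /cvgrPdist_lt/(_ _ d0) := @cvg_id _ (nbhs (h z)).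
rewrite -wy kP//; rewrite -wy in dy; rewrite ltNge; apply/negP => ezw.
by have := Ld w (conj Kw ezw); rewrite leNgt dy.
Unshelve. all: by end_near. Qed.

Lemma within_comp (T U V : topologicalType) (A : set T) (B : set U)
    (f : T -> U) (g : U -> V) :
  (forall t, A t -> B (f t)) -> {within A, continuous f} ->
  {within B, continuous g} -> {within A, continuous (g \o f)}.
Proof.
move=> AB /subspace_continuousP cf /subspace_continuousP cg.
apply/subspace_continuousP => t At.
have fAB : f @ within A (nbhs t) --> within B (nbhs (f t)).
  move=> C /(cf t At) fC; have tA : within A (nbhs t) A by exact: withinT.
  by apply: filterS2 tA fC => x Ax; apply; exact: AB.
exact: (cvg_comp f g fAB (cg _ (AB _ At))).
Qed.

(** The first component of the conjugacy is the coordinate built from [G] and [phi]. The second is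
    built from [F] with the axes exchanged, where [F] plays the part of the expanding map; its
    contraction [psi] is therefore the inverse of the vertical factor [psi']. *)
Lemma box_conjugacy r (F G : R * R -> R * R) (phi psi psi' : R -> R) :
  0 < r -> {within box r, continuous F} -> {within box r, continuous G} ->
  F (0, 0) = (0, 0) -> G (0, 0) = (0, 0) ->
  (forall z, box r z -> G (F z) = z) ->
  (forall z1 z2, box r z1 -> box r z2 -> hcone z1 z2 ->
    hcone (G z1) (G z2) /\ z2.1 - z1.1 < (G z2).1 - (G z1).1) ->
  (forall z1 z2, box r z1 -> box r z2 -> vcone z1 z2 ->
    vcone (F z1) (F z2) /\ z2.2 - z1.2 < (F z2).2 - (F z1).2) ->
  (forall z, box r z -> - r <= (G z).1 <= r -> box r (G z)) ->
  (forall z, box r z -> - r <= (F z).2 <= r -> box r (F z)) ->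
  interval_contraction r phi -> interval_contraction r psi ->
  (forall y : R, - r <= y <= r -> psi' (psi y) = y) ->
  exists N', [/\ nbhs ((0, 0) : R * R) N', N' `<=` box r &
    conjugate_on F (box r) (product_map phi psi') N'].
Proof.
move=> r0 cF cG F0 G0 GF Gexp Fexp Gexit Fexit cphi cpsi psiK.
have r0' := ltW r0.
have [A [cA bA A0 Ainc AG]] := box_fiber_coordinate r0 cG G0 Gexp Gexit cphi.
pose F' z := swap (F (swap z)).
have swapK z : swap (swap z) = z by case: z.
have cF' : {within box r, continuous F'}.
  apply: (@within_continuous_comp _ _ _ _ (F \o swap) swap).
    by move=> z _; exact: continuous_swap.
  apply: (within_comp (fun z => @box_swap r z) _ cF).
  exact: (continuous_subspaceT continuous_swap).
have [|||B [cB bB B0 Binc BF]] := box_fiber_coordinate r0 cF' _ _ _ cpsi.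
- by rewrite /F' /swap /= F0.
- by move=> z1 z2 b1 b2 h; exact: Fexp (box_swap b1) (box_swap b2) h.
- by move=> z bz /(Fexit _ (box_swap bz)) /box_swap.
pose h z := (A z, B (swap z)).
have cBs : continuous (fun z => B (swap z)).
  by move=> z; apply: (continuous_comp (@continuous_swap z)); exact: cB.
have ch : continuous h by exact: continuous_pair.
have Bsinc z1 z2 : box r z1 -> box r z2 -> vcone z1 z2 -> B (swap z1) < B (swap z2).
  by move=> b1 b2; apply: Binc; exact: box_swap.
have hinj z w : box r z -> box r w -> h z = h w -> z = w.
  move=> bz bw [Azw Bzw]; apply: contrapT => /cone_cover[|[|[|]]] c.
  - by have := Ainc _ _ bz bw c; rewrite Azw ltxx.
  - by have := Ainc _ _ bw bz c; rewrite Azw ltxx.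
  - by have := Bsinc _ _ bz bw c; rewrite Bzw ltxx.
  - by have := Bsinc _ _ bw bz c; rewrite Bzw ltxx.
exists (h @` box r); split.
- exact: (level_surjective r0 cA cBs A0 B0 Ainc Bsinc).
- move=> _ [z bz <-]; have /andP[? ?] := bA z; have /andP[? ?] := bB (swap z).
  by split.
exists h; split; first exact: (compact_homeomorphism (@box_compact _ r) ch hinj).
move=> z bz bFz; rewrite /h /product_map /=; congr pair.
  by rewrite AG ?GF.
by rewrite (BF _ (box_swap bz)) /F' swapK ?psiK//; exact: box_swap.
Qed.

(** Cone conditions on [F] alone suffice: read at [G z] and [G w], the condition on images says that
    [G] preserves and expands horizontal pairs. The larger box [rho] is there to contain these
    points. *)
Lemma cone_conjugacy (r rho : R) (F G : R * R -> R * R) (phi psi psi' : R -> R) :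
  0 < r -> r <= rho ->
  {within box r, continuous F} -> {within box r, continuous G} ->
  F (0, 0) = (0, 0) -> G (0, 0) = (0, 0) ->
  (forall z, box r z -> G (F z) = z) -> (forall z, box r z -> F (G z) = z) ->
  (forall z, box r z -> box rho (G z)) ->
  (forall z w, box rho z -> box rho w ->
    (vcone z w -> vcone (F z) (F w) /\ w.2 - z.2 < (F w).2 - (F z).2) /\
    (hcone (F z) (F w) -> hcone z w /\ (F w).1 - (F z).1 < w.1 - z.1)) ->
  interval_contraction r phi -> interval_contraction r psi ->
  (forall y : R, - r <= y <= r -> psi' (psi y) = y) ->
  exists N', [/\ nbhs ((0, 0) : R * R) N', N' `<=` box r &
    conjugate_on F (box r) (product_map phi psi') N'].
Proof.
move=> r0 rrho cF cG F0 G0 GF FG Gbox cones cphi cpsi psiK.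
have sub z : box r z -> box rho z by move=> [? ? ? ?]; split; lra.
have b0 : box rho (0, 0) by split=> /=; lra.
apply: (@box_conjugacy r F G phi psi psi') => //.
- move=> z1 z2 b1 b2 h; have [_] := cones _ _ (Gbox _ b1) (Gbox _ b2).
  by rewrite !FG//; exact.
- move=> z1 z2 b1 b2 h.
  by have [h1 _] := cones _ _ (sub _ b1) (sub _ b2); exact: h1.
(* If [G z] were above or below the box, it would be in vertical position to the origin, and [F]
   would move it still farther from the horizontal axis; but [F (G z) = z] lies in the box. *)
- move=> z bz /andP[w1 w2]; have bw := Gbox _ bz; have [_ _ z3 z4] := bz.
  have [up _] := cones _ _ b0 bw; have [down _] := cones _ _ bw b0.
  rewrite F0 FG// in up down.
  split=> //; rewrite leNgt; apply/negP => lt.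
    have [|_] := down; first by split=> /=; lra.
    by rewrite /=; lra.
  have [|_] := up; first by split=> /=; lra.
  by rewrite /=; lra.
(* If [F z] were to the right or left of the box, it would be in horizontal position to the origin,
   so [z] would lie even farther from the vertical axis. *)
- move=> z bz /andP[w1 w2]; have [z1 z2 _ _] := bz.
  have [_ right] := cones _ _ b0 (sub _ bz); have [_ left] := cones _ _ (sub _ bz) b0.
  rewrite F0 in right left.
  split=> //; rewrite leNgt; apply/negP => lt.
    have [|_] := left; first by split=> /=; lra.
    by rewrite /=; lra.
  have [|_] := right; first by split=> /=; lra.
  by rewrite /=; lra.
Qed.

End BoxConjugacy.

(** * Differential calculus in the plane *)

Section PlaneCalculus.
Context {R : realType}.
Implicit Types (z w v : R * R) (h : R * R -> R).

Lemma is_derive_line h w v (s : R) : derivable h (s *: v + w) v ->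
  is_derive s (1 : R) (fun t : R => h (t *: v + w)) ('D_v h (s *: v + w)).
Proof.
move=> dh.
have E : (fun t : R => t^-1 *: (((fun t => h (t *: v + w)) \o shift s) (t *: (1 : R))
      - h (s *: v + w))) =
    (fun t : R => t^-1 *: ((h \o shift (s *: v + w)) (t *: v) - h (s *: v + w))).
  apply/funext => t /=; congr (_ *: (h _ - _)).
  by rewrite [t%:A]mulr1 scalerDl addrA.
by split; rewrite /derivable /derive E.
Qed.

Lemma segment_MVT h v w (s t : R) : (forall z, derivable h z v) -> s < t ->
  exists2 c : R, s < c < t &
    h (t *: v + w) - h (s *: v + w) = 'D_v h (c *: v + w) * (t - s).
Proof.
move=> dh st; pose f (t : R) := h (t *: v + w).
have df (x : R) : is_derive x (1 : R) f ('D_v h (x *: v + w)).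
  exact: is_derive_line.
have [|c] := @MVT R f (fun s => 'D_v h (s *: v + w)) s t st.
  by apply: derivable_within_continuous => x _; have [] := df x.
by rewrite in_itv/= => cst E; exists c.
Qed.

Lemma directional_MVT h v w (t : R) : (forall z, derivable h z v) ->
  exists2 c : R, `|c| <= `|t| & h (t *: v + w) - h w = 'D_v h (c *: v + w) * t.
Proof.
move=> dh; have h0 : h (0 *: v + w) = h w by rewrite scale0r add0r.
have [t0|t0|<-] := ltgtP 0 t.
- have [c /andP[c0 ct] E] := segment_MVT w dh t0; exists c.
    by rewrite !gtr0_norm// ltW.
  by rewrite -h0 E subr0.
- have [c /andP[ct c0] E] := segment_MVT w dh t0; exists c.
    by rewrite !ltr0_norm// lerN2 ltW.
  by rewrite -h0 -[LHS]opprK opprB E; ring.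
- by exists 0; rewrite ?h0 ?subrr ?mulr0.
Qed.

Lemma axes_decomposition (a b : R) z :
  a *: ((1, 0) : R * R) + (b *: ((0, 1) : R * R) + z) = (a, b) + z.
Proof. by case: z => x y; congr pair; rewrite /= /GRing.scale /=; ring. Qed.

(** The increment is split into a vertical move followed by a horizontal one. The mean value theorem
    on each, with continuity of the partial derivatives at [z], bounds the error by [e] times the
    norm. *)
Lemma C1_differentiable h z : C1 h ->
  differentiable h z /\ forall v, 'd h z v = dx h z * v.1 + dy h z * v.2.
Proof.
move=> [hx hy cx cy].
pose L v : R := dx h z * v.1 + dy h z * v.2.
have linL : linear L.
  by move=> a [u1 u2] [v1 v2]; rewrite /L /= /GRing.scale /=; ring.
pose LM := GRing.isLinear.Build _ _ _ _ _ linL.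
pose dL : {linear (R * R)%type -> R} := HB.pack L LM.
have cL : continuous dL.
  move=> v; apply: cvgD; (apply: cvgM; first exact: cvg_cst).
    exact: continuous_fst.
  exact: continuous_snd.
have hL : h \o shift z = cst (h z) + (dL : R * R -> R) +o_ (0 : R * R) id.
  apply/eqaddoP => e e0 /=.
  have e2 : 0 < e / 2 by rewrite divr_gt0.
  have /cvgrPdist_lt/(_ _ e2)/nbhs_ballP[d1 /= d10 Hx] := cx z.
  have /cvgrPdist_lt/(_ _ e2)/nbhs_ballP[d2 /= d20 Hy] := cy z.
  apply/nbhs_ballP; exists (Num.min d1 d2); first by rewrite /= lt_min d10 d20.
  move=> -[u1 u2] [/=]; rewrite /ball /= !sub0r !normrN !lt_min.
  move=> /andP[u1d1 u1d2] /andP[u2d1 u2d2].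
  have [c1 c1u E1] := directional_MVT (u2 *: ((0, 1) : R * R) + z) u1 hx.
  have [c2 c2u E2] := directional_MVT z u2 hy.
  have {}Hx : `|dx h z - dx h (c1 *: (1, 0) + (u2 *: (0, 1) + z))| < e / 2.
    apply: Hx; split; rewrite /ball /= /GRing.scale /=.
      rewrite (_ : _ - _ = - c1); last by ring.
      by rewrite normrN (le_lt_trans c1u).
    by rewrite (_ : _ - _ = - u2) ?normrN//; ring.
  have {}Hy : `|dy h z - dy h (c2 *: (0, 1) + z)| < e / 2.
    apply: Hy; split; rewrite /ball /= /GRing.scale /=.
      by rewrite (_ : _ - _ = 0) ?normr0//; ring.
    rewrite (_ : _ - _ = - c2); last by ring.
    by rewrite normrN (le_lt_trans c2u).
  have -> : (h \o shift z - (cst (h z) + dL)) (u1, u2) =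
      - ((dx h z - dx h (c1 *: (1, 0) + (u2 *: (0, 1) + z))) * u1
      + (dy h z - dy h (c2 *: (0, 1) + z)) * u2).
    rewrite mulrBl mulrBl -E1 -E2 /= /L /=.
    rewrite (_ : u1 *: (1, 0) + (u2 *: (0, 1) + z) = (u1, u2) + z).
      rewrite -[(_ - _) _]/(h ((u1, u2) + z) - (h z + L (u1, u2))) /L /=; ring.
    exact: axes_decomposition.
  rewrite normrN (le_trans (ler_normD _ _))// !normrM prod_normE/=.
  set M := Num.max _ _.
  have M1 : `|u1| <= M by rewrite le_max lexx.
  have M2 : `|u2| <= M by rewrite le_max lexx orbT.
  rewrite [e]splitr mulrDl; apply: lerD; apply: ler_pM => //; exact: ltW.
have dE : 'd h z = dL :> (R * R -> R) by exact: diff_unique.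
split; last by move=> v; rewrite dE.
by apply/diff_locallyP; rewrite dE.
Qed.

Lemma C1_continuous h : C1 h -> continuous h.
Proof.
by move=> /C1_differentiable d z; have [/differentiable_continuous] := d z.
Qed.

Lemma C1_is_derive h z v : C1 h ->
  is_derive z v h (dx h z * v.1 + dy h z * v.2).
Proof.
move=> /(C1_differentiable z)[dh dhE]; split; first exact: diff_derivable.
by rewrite deriveE.
Qed.

End PlaneCalculus.

(** * Polynomial functions and their formal derivatives *)

Section PolynomialCalculus.
Context {R : realType}.
Implicit Types (z w v : R * R) (p q : mpoly 2 R).

Let smooth p := continuous (polyfun p) /\
  forall z v, is_derive z v (polyfun p)
    (polyfun (dpx p) z * v.1 + polyfun (dpy p) z * v.2).

Lemma polyfunD p q : polyfun (p + q) = polyfun p + polyfun q.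
Proof. by apply/funext => z; rewrite /polyfun mevalD. Qed.

Lemma polyfunB p q z : polyfun (p - q) z = polyfun p z - polyfun q z.
Proof. by rewrite /polyfun mevalB. Qed.

Lemma polyfunM p q : polyfun (p * q) = polyfun p * polyfun q.
Proof. by apply/funext => z; rewrite /polyfun mevalM. Qed.

Lemma polyfunZ c p : polyfun (c *: p) = cst c * polyfun p.
Proof. by apply/funext => z; rewrite /polyfun mevalZ. Qed.

Lemma is_derive_fst z v : is_derive z v (fst : R * R -> R) v.1.
Proof.
have d : differentiable (fst : R * R -> R) z.
  exact/linear_differentiable/continuous_fst.
split; first exact: diff_derivable.
by rewrite deriveE// diff_lin//; exact: continuous_fst.
Qed.

Lemma is_derive_snd z v : is_derive z v (snd : R * R -> R) v.2.
Proof.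
have d : differentiable (snd : R * R -> R) z.
  exact/linear_differentiable/continuous_snd.
split; first exact: diff_derivable.
by rewrite deriveE// diff_lin//; exact: continuous_snd.
Qed.

Let smoothC c : smooth (mpolyC 2 c).
Proof.
have E : polyfun (mpolyC 2 c) = cst c.
  by apply/funext => z; rewrite /polyfun mevalC.
split=> [|z v]; rewrite E; first exact: cst_continuous.
apply: is_derive_eq.
by rewrite /dpx /dpy !mderivC /polyfun !meval0 !mul0r addr0.
Qed.

Let smoothD p q : smooth p -> smooth q -> smooth (p + q).
Proof.
move=> [cp dp] [cq dq]; split=> [z|z v]; rewrite polyfunD.
  by apply: continuousD; [exact: cp|exact: cq].
have := dp z v; have := dq z v => ? ?; apply: is_derive_eq.
by rewrite /dpx /dpy !mderivD !polyfunD /= !fctE; ring.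
Qed.

Let smoothM p q : smooth p -> smooth q -> smooth (p * q).
Proof.
move=> [cp dp] [cq dq]; split=> [z|z v]; rewrite polyfunM.
  by apply: continuousM; [exact: cp|exact: cq].
have := dp z v; have := dq z v => ? ?; apply: is_derive_eq.
rewrite /dpx /dpy !mderivM !polyfunD !polyfunM /= !fctE /GRing.scale /=; ring.
Qed.

Let smoothZ c p : smooth p -> smooth (c *: p).
Proof. by move=> sp; rewrite -mul_mpolyC; apply: smoothM. Qed.

Let smoothXn p n : smooth p -> smooth (p ^+ n).
Proof.
move=> sp; elim: n => [|n IH]; first by rewrite expr0 -mpolyC1.
by rewrite exprS; apply: smoothM.
Qed.

Let smoothX (i : 'I_2) : smooth (mpolyX R (mnm1 i)).
Proof.
have E : polyfun (mpolyX R (mnm1 i)) = if i == ord0 then fst else snd.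
  by apply/funext => z; rewrite /polyfun mevalXU; case: ifP.
split=> [|z v]; rewrite E.
  by case: ifP => _; [exact: continuous_fst|exact: continuous_snd].
have -> : polyfun (dpx (mpolyX R (mnm1 i))) z * v.1 +
    polyfun (dpy (mpolyX R (mnm1 i))) z * v.2 = if i == ord0 then v.1 else v.2.
  rewrite /dpx /dpy !mderivX !polyfunZ /polyfun /= !fctE !mnm1E !mevalX.
  rewrite !big_ord_recl !big_ord0 !mnmBE !mnm1E.
  by case: i {E} => -[|[|]]//= ?; rewrite ?expr0 /=; ring.
by case: ifP => _; [exact: is_derive_fst|exact: is_derive_snd].
Qed.

(** Constants and variables satisfy the property, and it is stable under sums and products; a
    monomial is a product of powers of the variables. *)
Lemma polyfun_smooth p : smooth p.
Proof.
elim/mpolyind: p => [|c m p _ _ IH]; first by rewrite -mpolyC0.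
apply: smoothD => //; apply: smoothZ.
by rewrite mpolyXE_id !big_ord_recl big_ord0 mulr1; apply: smoothM; apply: smoothXn.
Qed.

Lemma continuous_polyfun p : continuous (polyfun p).
Proof. by case: (polyfun_smooth p). Qed.

Lemma is_derive_polyfun p z v : is_derive z v (polyfun p)
  (polyfun (dpx p) z * v.1 + polyfun (dpy p) z * v.2).
Proof. by case: (polyfun_smooth p). Qed.

End PolynomialCalculus.

(** * Monotonicity along segments *)

Section Increments.
Context {R : realType}.
Implicit Types (z w v : R * R) (h : R * R -> R) (L : R * R -> R * R -> R).

Lemma segment_box (r s : R) z w : 0 <= s <= 1 -> box r z -> box r w ->
  box r (s *: (w - z) + z).
Proof.
case: z w => [x y] [x' y'] /andP[s0 s1] [/= ? ? ? ?] [/= ? ? ? ?].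
by split; rewrite /= /GRing.scale /=; nra.
Qed.

Lemma increment_ge0 r h L z w :
  (forall z v, is_derive z v h (L z v)) -> box r z -> box r w ->
  (forall u, box r u -> 0 <= L u (w - z)) -> h z <= h w.
Proof.
move=> dh bz bw L0.
have d u : derivable h u (w - z).
  exact: (@ex_derive _ _ _ _ _ _ _ (dh u (w - z))).
have [c /andP[c0 c1]] := @segment_MVT _ h (w - z) z 0 1 d ltr01.
rewrite scale1r subrK scale0r add0r subr0 mulr1 => E.
rewrite -subr_ge0 E (@derive_val _ _ _ _ _ _ _ (dh _ _)); apply: L0.
by apply: segment_box => //; rewrite !ltW.
Qed.

(** The derivative may vanish at the origin, where the cone forms degenerate. The mean value theorem
    is applied to each half of the segment: the two intermediate points are distinct, so at least
    one is not the origin and contributes strictly. *)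
Lemma increment_gt0 r h L z w :
  (forall z v, is_derive z v h (L z v)) -> z <> w -> box r z -> box r w ->
  0 <= L (0, 0) (w - z) ->
  (forall u, box r u -> u != (0, 0) -> 0 < L u (w - z)) -> h z < h w.
Proof.
move=> dh zw bz bw L00 L0.
have d u : derivable h u (w - z).
  exact: (@ex_derive _ _ _ _ _ _ _ (dh u (w - z))).
have h2 : 0 < 2^-1 :> R by rewrite invr_gt0.
have h21 : 2^-1 < 1 :> R by rewrite invf_lt1// ltr1n.
have [c1 /andP[c10 c12]] := @segment_MVT _ h (w - z) z 0 2^-1 d h2.
have [c2 /andP[c20 c21]] := @segment_MVT _ h (w - z) z 2^-1 1 d h21.
rewrite scale1r subrK scale0r add0r subr0.
rewrite !(@derive_val _ _ _ _ _ _ _ (dh _ _)) => E2 E1.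
have Lge0 u : box r u -> 0 <= L u (w - z).
  by have [-> //|u0 bu] := eqVneq u (0, 0); exact/ltW/L0.
have b1 : box r (c1 *: (w - z) + z).
  by apply: segment_box => //; apply/andP; split; apply/ltW => //; apply: lt_trans h21.
have b2 : box r (c2 *: (w - z) + z).
  by apply: segment_box => //; apply/andP; split; apply/ltW => //; apply: lt_trans c20.
have L1 := Lge0 _ b1; have L2 := Lge0 _ b2.
have hh : 1 - 2^-1 = 2^-1 :> R by rewrite [X in X - _](splitr 1) mul1r addrK.
rewrite hh in E2.
have [e1|n1] := eqVneq (c1 *: (w - z) + z) (0, 0).
  have n2 : c2 *: (w - z) + z != (0, 0).
    apply/eqP => e2; have : (c2 - c1) *: (w - z) = 0.
      rewrite scalerBl -(addrK z (c2 *: _)) e2 -e1 addrK subrr//.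
    move/eqP; rewrite scaler_eq0 !subr_eq0 => /orP[/eqP e|/eqP e].
      by move: c12; rewrite -e ltNge ltW.
    exact: zw.
  have := L0 _ b2 n2; nra.
have := L0 _ b1 n1; nra.
Qed.

End Increments.

(** * Positive definite forms and higher-order terms *)

Section Definiteness.
Context {R : realType}.
Implicit Types (z w v : R * R) (p q : mpoly 2 R).

(** The form has a positive lower bound on the unit sphere by compactness, and homogeneity of degree
    [m] spreads it to the plane. *)
Lemma coefficient_tensor_bound m p (B : tensor R m 2) :
  is_coefficient_tensor p B -> tensor_posdef B ->
  exists2 c : R, 0 < c & forall z, c * `|z| ^+ m <= polyfun p z.
Proof.
move=> [_ pB] posB.
pose row2 z : 'rV[R]_2 := \row_i (if i == ord0 then z.1 else z.2).
have E z : polyfun p z = tensor_form B (row2 z).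
  by rewrite -pB /polyfun; apply: meval_eq => i; rewrite mxE.
have hom (a : R) z : polyfun p (a *: z) = a ^+ m * polyfun p z.
  rewrite !E /tensor_form mulr_sumr; apply: eq_bigr => i _.
  rewrite mulrCA; congr (_ * _).
  rewrite (eq_bigr (fun l => a * row2 z ord0 (i l))); last first.
    by move=> l _; rewrite !mxE; case: ifP.
  by rewrite big_split /= prodr_const card_ord.
pose K : set (R * R) := box 1 `&` [set z | `|z| = 1].
have cK : compact K.
  apply: compact_closedI; first exact: box_compact.
  apply: (@closed_comp _ _ (fun z => `|z|) [set x : R | x = 1]).
    by move=> z _; exact: norm_continuous.
  exact: closed_eq.
have [c c0 Kc] : exists2 c : R, 0 < c & forall z, K z -> c <= polyfun p z.
  apply: positive_lower_bound => //.
    exact/continuous_subspaceT/continuous_polyfun.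
  move=> z [_ /= z1]; rewrite E; apply: posB; apply/eqP => z0.
  have e1 : z.1 = 0 by have := congr1 (fun A : 'rV_2 => A ord0 ord0) z0; rewrite !mxE.
  have e2 : z.2 = 0.
    by have := congr1 (fun A : 'rV_2 => A ord0 ord_max) z0; rewrite !mxE.
  by move: z1; rewrite prod_normE e1 e2 normr0 maxxx => /esym/eqP; rewrite oner_eq0.
exists c => // z.
have [u [u1 zu]] : exists u, `|u| = 1 /\ z = `|z| *: u.
  have [->|z0] := eqVneq z 0.
    exists (1, 0); rewrite normr0 scale0r; split=> //.
    by rewrite prod_normE /= normr1 normr0 max_l.
  exists (`|z|^-1 *: z); rewrite scalerA divff ?normr_eq0// scale1r; split=> //.
  by rewrite normrZ normfV normr_id mulVf// normr_eq0.
rewrite {2}zu hom mulrC; apply: ler_wpM2l; first by rewrite exprn_ge0.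
apply: Kc; split=> //; have := u1; rewrite prod_normE => u1'.
have n1 : `|u.1| <= 1 by rewrite -u1' le_max lexx.
have n2 : `|u.2| <= 1 by rewrite -u1' le_max lexx orbT.
by move: n1 n2; rewrite !ler_norml => /andP[? ?] /andP[? ?]; split.
Qed.

Lemma coefficient_tensor0 m p (B : tensor R m 2) :
  (0 < m)%N -> is_coefficient_tensor p B -> polyfun p (0, 0) = 0.
Proof.
move=> m0 [_ pB].
have -> : polyfun p (0, 0) = tensor_form B 0.
  by rewrite -pB /polyfun; apply: meval_eq => i; rewrite mxE; case: ifP.
rewrite /tensor_form big1// => i _; case: m m0 B pB i => // m _ B pB i.
by rewrite big_ord_recl mxE mul0r mulr0.
Qed.

Lemma homogeneous0 d p : (0 < d)%N -> homogeneous d p -> polyfun p (0, 0) = 0.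
Proof.
move=> d0 /dhomogP hom; rewrite /polyfun mevalE big_seq big1// => m /hom dm.
rewrite !big_ord_recl big_ord0 /= mulr1.
have : (m ord0 + m (lift ord0 ord0) = d)%N.
  by have := mdegE m; rewrite dm !big_ord_recl big_ord0 addn0.
case: (m ord0) => [|n]; last by rewrite expr0n /= mul0r mulr0.
by rewrite add0n => ->; rewrite !expr0n; case: d d0 {hom dm} => //= *; rewrite !mulr0.
Qed.

(** The neighborhood filter is not punctured, so the little-o bound holds at the origin itself. *)
Lemma littleo0 d (e : R * R -> R) : (0 < d)%N ->
  e =o_ (nbhs ((0, 0) : R * R)) (fun z => `|z| ^+ d) -> e (0, 0) = 0.
Proof.
move=> d0 /eqoP/(_ _ ltr01)/nbhs_singleton.
have -> : `|((0, 0) : R * R)| = 0 by rewrite prod_normE /= normr0 maxxx.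
by rewrite expr0n eqn0Ngt d0 /= normr0 mulr0 normr_le0 => /eqP.
Qed.

(** Definiteness of both [p + q] and [p - q] means that [p - |q|] is at least [c * |z| ^+ d] with
    [c] positive; near the origin the two remainders use up at most two thirds of this. *)
Lemma dominance d (p q : mpoly 2 R) (B C : tensor R d 2) (e e' : R * R -> R) :
  is_coefficient_tensor (p + q) B -> is_coefficient_tensor (p - q) C ->
  tensor_posdef B -> tensor_posdef C ->
  e =o_ (nbhs ((0, 0) : R * R)) (fun z => `|z| ^+ d) ->
  e' =o_ (nbhs ((0, 0) : R * R)) (fun z => `|z| ^+ d) ->
  \forall z \near nbhs ((0, 0) : R * R), z != (0, 0) ->
    `|polyfun q z| + `|e' z| < polyfun p z - `|e z|.
Proof.
move=> pB pC posB posC /eqoP he /eqoP he'.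
have [c1 c10 H1] := coefficient_tensor_bound pB posB.
have [c2 c20 H2] := coefficient_tensor_bound pC posC.
pose c := Num.min c1 c2; have c0 : 0 < c by rewrite lt_min c10 c20.
have c3 : 0 < c / 3 by rewrite divr_gt0.
apply: filterS2 (he _ c3) (he' _ c3) => z ez e'z z0.
have zn : 0 < `|z| ^+ d.
  rewrite exprn_gt0// normr_gt0.
  by apply: contraNneq z0 => ->.
rewrite (ger0_norm (ltW zn)) in ez e'z.
have := H1 z; have := H2 z; rewrite polyfunB polyfunD /= fctE => h2 h1.
have m1 : c * `|z| ^+ d <= c1 * `|z| ^+ d.
  by apply: ler_wpM2r; [exact: ltW|rewrite ge_min lexx].
have m2 : c * `|z| ^+ d <= c2 * `|z| ^+ d.
  by apply: ler_wpM2r; [exact: ltW|rewrite ge_min lexx orbT].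
have q1 : `|polyfun q z| <= polyfun p z - c * `|z| ^+ d.
  rewrite ler_norml; apply/andP; split; lra.
have : 0 < c * `|z| ^+ d by rewrite mulr_gt0.
lra.
Qed.

End Definiteness.

(** * Cone conditions *)

Section ConeConditions.
Context {R : realType}.
Implicit Types (z w v : R * R).

(** Nonnegativity of the linear forms [a * x + b * y] and [a * x - b * y] in the cone [|y| <= x]. *)
Lemma cone_form_ge0 (a b x y : R) : `|b| <= a -> - x <= y <= x ->
  - (a * x) <= b * y <= a * x.
Proof. by move=> ba /andP[y1 y2]; rewrite -ler_norml normrM ler_pM// ler_norml y1. Qed.

Lemma cone_form_gt0 (a b x y : R) : `|b| < a -> 0 < x -> - x <= y <= x ->
  - (a * x) < b * y < a * x.
Proof.
move=> ba x0 /andP[y1 y2]; rewrite -ltr_norml normrM.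
apply: (@le_lt_trans _ _ (`|b| * x)); last by rewrite ltr_pM2r.
by rewrite ler_wpM2l// ler_norml y1.
Qed.

Variables (F : R * R -> R * R) (a1 a2 b1 b2 : R * R -> R) (r : R).
Hypothesis dF1 : forall z v, is_derive z v (fun z => (F z).1)
  (v.1 - (a1 z * v.1 + a2 z * v.2)).
Hypothesis dF2 : forall z v, is_derive z v (fun z => (F z).2)
  (v.2 + (b1 z * v.1 + b2 z * v.2)).
Hypothesis a10 : a1 (0, 0) = 0.
Hypothesis a20 : a2 (0, 0) = 0.
Hypothesis b10 : b1 (0, 0) = 0.
Hypothesis b20 : b2 (0, 0) = 0.
Hypothesis a_dom : forall z, box r z -> z != (0, 0) -> `|a2 z| < a1 z.
Hypothesis b_dom : forall z, box r z -> z != (0, 0) -> `|b1 z| < b2 z.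
Hypothesis a1_small : forall z, box r z -> a1 z <= 2^-1.

Let a_dom_le z : box r z -> `|a2 z| <= a1 z.
Proof.
by move=> bz; have [->|/(a_dom bz)/ltW//] := eqVneq z (0, 0); rewrite a10 a20 normr0.
Qed.

(** In a direction [v] of the horizontal cone, the derivative of [z.1 - (F z).1] is
    [a1 * v.1 + a2 * v.2], positive off the origin since [|a2| < a1]. It is at most [2 * a1 * v.1],
    hence at most [v.1], so the first coordinates keep their order weakly. *)
Lemma hcone_contraction z w : box r z -> box r w -> hcone z w ->
  0 <= (F w).1 - (F z).1 < w.1 - z.1.
Proof.
move=> bz bw [zw1 zw2 zw3].
have v1 : 0 < (w - z).1 by rewrite subr_gt0.
have v2 : - (w - z).1 <= (w - z).2 <= (w - z).1 by apply/andP; split=> /=; lra.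
apply/andP; split.
  rewrite subr_ge0.
  apply: (increment_ge0 dF1 bz bw) => u bu.
  have /andP[h1 h2] := cone_form_ge0 (a_dom_le bu) v2.
  have a0 := le_trans (normr_ge0 _) (a_dom_le bu).
  have h := a1_small bu.
  have h3 : a1 u * (w - z).1 <= 2^-1 * (w - z).1 by rewrite ler_pM2r.
  lra.
have dh u x : is_derive u x (fun z => z.1 - (F z).1) (a1 u * x.1 + a2 u * x.2).
  apply: (is_derive_eq (is_deriveB (is_derive_fst u x) (dF1 u x))); ring.
have zw : z <> w by move=> e; move: zw1; rewrite e ltxx.
have L0 : 0 <= a1 (0, 0) * (w - z).1 + a2 (0, 0) * (w - z).2.
  by rewrite a10 a20 !mul0r addr0.
suff : z.1 - (F z).1 < w.1 - (F w).1 by lra.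
apply: (increment_gt0 dh zw bz bw L0) => u bu u0.
have /andP[h1 h2] := cone_form_gt0 (a_dom bu u0) v1 v2; lra.
Qed.

Lemma vcone_expansion z w : box r z -> box r w -> vcone z w ->
  [/\ (F w).1 - (F z).1 <= w.2 - z.2, (F z).1 - (F w).1 <= w.2 - z.2 &
      w.2 - z.2 < (F w).2 - (F z).2].
Proof.
move=> bz bw [/= zw1 zw2 zw3].
have v1 : 0 < (w - z).2 by rewrite subr_gt0.
have v2 : - (w - z).2 <= (w - z).1 <= (w - z).2 by apply/andP; split=> /=; lra.
have zw : z <> w by move=> e; move: zw1; rewrite e ltxx.
have dh u x : is_derive u x (fun z => (F z).2 - z.2) (b1 u * x.1 + b2 u * x.2).
  apply: (is_derive_eq (is_deriveB (dF2 u x) (is_derive_snd u x))); ring.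
have dm u x : is_derive u x (fun z => z.2 - (F z).1)
    (x.2 - (x.1 - (a1 u * x.1 + a2 u * x.2))).
  exact: (is_deriveB (is_derive_snd u x) (dF1 u x)).
have dp u x : is_derive u x (fun z => z.2 + (F z).1)
    (x.2 + (x.1 - (a1 u * x.1 + a2 u * x.2))).
  exact: (is_deriveD (is_derive_snd u x) (dF1 u x)).
have L0 : 0 <= b1 (0, 0) * (w - z).1 + b2 (0, 0) * (w - z).2.
  by rewrite b10 b20 !mul0r addr0.
have g : w.2 - z.2 < (F w).2 - (F z).2.
  suff : (F z).2 - z.2 < (F w).2 - w.2 by lra.
  apply: (increment_gt0 dh zw bz bw L0) => u bu u0.
  have /andP[h1 h2] := cone_form_gt0 (b_dom bu u0) v1 v2; lra.
have v2' : - (w - z).2 <= (w - z).2 <= (w - z).2 by apply/andP; split=> /=; lra.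
have bnd u : box r u ->
    - (w - z).2 <= (w - z).1 - (a1 u * (w - z).1 + a2 u * (w - z).2) <= (w - z).2.
  move=> bu; have ad := a_dom_le bu.
  have /andP[h1 h2] := cone_form_ge0 ad v2'.
  have h := a1_small bu; have h0 := le_trans (normr_ge0 _) ad.
  have c0 : `|1 - a1 u| <= 1 - a1 u by rewrite ger0_norm//; lra.
  have /andP[h3 h4] := cone_form_ge0 c0 v2.
  by apply/andP; split; lra.
have m : z.2 - (F z).1 <= w.2 - (F w).1.
  by apply: (increment_ge0 dm bz bw) => u /bnd/andP[h1 h2]; rewrite subr_ge0.
have p : z.2 + (F z).1 <= w.2 + (F w).1.
  by apply: (increment_ge0 dp bz bw) => u /bnd/andP[h1 h2]; lra.
by split=> //; lra.
Qed.

(** The invariance of horizontal pairs under the inverse is obtained without differentiating it.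
    Among the four relative positions of [z] and [w], a vertical one would give images with vertical
    separation larger than the horizontal one, and the reversed horizontal one would give images in
    the wrong order. *)
Lemma hcone_preimage z w : box r z -> box r w -> hcone (F z) (F w) ->
  hcone z w /\ (F w).1 - (F z).1 < w.1 - z.1.
Proof.
move=> bz bw FF; have [F1 F2 F3] := FF.
have zw : z <> w by move=> e; move: F1; rewrite e ltxx.
have [c|[c|[c|c]]] := cone_cover zw.
- by split=> //; have /andP[] := hcone_contraction bz bw c.
- by exfalso; have /andP[] := hcone_contraction bw bz c; lra.
- by exfalso; have [? ? ?] := vcone_expansion bz bw c; lra.
- by exfalso; have [? ? ?] := vcone_expansion bw bz c; lra.
Qed.

End ConeConditions.

(** * Cones and signs for the planar map *)

Section PlanarMap.
Context {R : realType}.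
Implicit Types (z w v : R * R).

Lemma nbhs_box (S : set (R * R)) : nbhs ((0, 0) : R * R) S ->
  exists2 r : R, 0 < r & box r `<=` S.
Proof.
move=> /nbhs_ballP[e /= e0 eS]; exists (e / 2); first by rewrite divr_gt0.
move=> [x y] [/= ? ? ? ?]; apply: eS.
by split; rewrite /ball /= sub0r normrN; apply: (@le_lt_trans _ _ (e / 2));
  rewrite ?ler_norml; (try by apply/andP; split); lra.
Qed.

Lemma box_nbhs (r : R) : 0 < r -> nbhs ((0, 0) : R * R) (box r).
Proof.
move=> r0; apply/nbhs_ballP; exists r => //= -[x y] [/=].
rewrite /ball /= !sub0r !normrN !ltr_norml => /andP[? ?] /andP[? ?].
by split; exact: ltW.
Qed.

Lemma box_sub (r s : R) : r <= s -> box r `<=` box s.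
Proof. by move=> rs z [? ? ? ?]; split; lra. Qed.

(** The functions [c] and [d] stand for the two coordinates in either order. At the origin [f] has
    derivative [c], so in the sector [|d w| <= k * |c w|] near the origin it has the sign of [c]. *)
Lemma sign_preserving (c d f l1 l2 : R * R -> R) (k : R) :
  (forall w, c (- w) = - c w) -> (forall w, d (- w) = - d w) ->
  (forall z v, is_derive z v f (c v + (l1 z * c v + l2 z * d v))) ->
  continuous l1 -> continuous l2 -> l1 (0, 0) = 0 -> l2 (0, 0) = 0 ->
  f (0, 0) = 0 -> 0 <= k ->
  exists2 r : R, 0 < r & forall w, box r w -> `|d w| <= k * `|c w| ->
    c w != 0 -> 0 < f w * c w.
Proof.
move=> cN dN df cl1 cl2 l10 l20 f0 k0.
(* With both coefficients below [e], the deviation from [c w] is less than [e * (1 + k) * |c w|],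
   which is half of [|c w|]. *)
pose e : R := (2 * (k + 1))^-1.
have e0 : 0 < e by rewrite invr_gt0; lra.
have near_e (l : R * R -> R) : continuous l -> l (0, 0) = 0 ->
    \forall z \near nbhs ((0, 0) : R * R), `|l z| < e.
  move=> cl l0; have /cvgrPdist_lt/(_ _ e0) := cl (0, 0).
  by rewrite l0; apply: filterS => z; rewrite sub0r normrN.
have [r r0 rP] := nbhs_box (filterI (near_e _ cl1 l10) (near_e _ cl2 l20)).
exists r => // w bw dw cw.
have b0 : box r (0, 0) by split=> /=; lra.
have w0 : w <> (0, 0).
  move=> w0; move/eqP : cw; apply; rewrite w0.
  by have := cN (0, 0); rewrite (_ : - (0, 0) = (0, 0)) => [|];
    [lra|rewrite -[LHS]/(- 0, - 0) oppr0].
have bound u : box r u -> `|l1 u * c w + l2 u * d w| < `|c w|.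
  move=> bu; have [/= h1 h2] := rP u bu.
  apply: le_lt_trans (ler_normD _ _) _; rewrite !normrM.
  have cw0 : 0 < `|c w| by rewrite normr_gt0.
  have t1 : `|l1 u| * `|c w| < e * `|c w| by rewrite ltr_pM2r.
  have t2 : `|l2 u| * `|d w| <= e * (k * `|c w|) by apply: ler_pM => //; exact: ltW.
  have t3 : e * `|c w| + e * (k * `|c w|) = 2^-1 * `|c w|.
    by rewrite /e; field; lra.
  lra.
have wE : w - (0, 0) = w by rewrite -[(0, 0)]/(0 : R * R) subr0.
have NwE : (0, 0) - w = - w by rewrite -[(0, 0)]/(0 : R * R) sub0r.
have [cw0|cw0|/eqP] := ltgtP (c w) 0; last by rewrite (negbTE cw).
  have fw : f w < f (0, 0).
    apply: (increment_gt0 df w0 bw b0); rewrite NwE cN dN.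
      by rewrite l10 l20 !mul0r !addr0; lra.
    move=> u /bound + _; rewrite (ltr0_norm cw0) ltr_norml => /andP[? ?]; lra.
  by rewrite nmulr_rgt0// -f0.
have fw : f (0, 0) < f w.
  apply: (increment_gt0 df (fun e => w0 (esym e)) b0 bw); rewrite wE.
    by rewrite l10 l20 !mul0r !addr0; lra.
  move=> u /bound + _; rewrite (gtr0_norm cw0) ltr_norml => /andP[? ?]; lra.
by rewrite mulr_gt0// -f0.
Qed.

Variables (k k' : nat) (P Q : mpoly 2 R) (X Y : R * R -> R).
Hypothesis hX : higher_order (2 * k) X.
Hypothesis hY : higher_order (2 * k') Y.

Let a1 z : R := polyfun (dpx P) z - dx X z.
Let a2 z : R := polyfun (dpy P) z - dy X z.
Let b1 z : R := polyfun (dpx Q) z + dx Y z.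
Let b2 z : R := polyfun (dpy Q) z + dy Y z.
Let F := planar_map P Q X Y.

Let dF1 z v : is_derive z v (fun z => (F z).1)
  (v.1 - (a1 z * v.1 + a2 z * v.2)).
Proof.
have [cX _ _ _] := hX.
apply: (is_derive_eq (is_deriveD (is_deriveB (is_derive_fst z v)
  (is_derive_polyfun P z v)) (C1_is_derive z v cX))).
rewrite /a1 /a2; ring.
Qed.

Let dF2 z v : is_derive z v (fun z => (F z).2)
  (v.2 + (b1 z * v.1 + b2 z * v.2)).
Proof.
have [cY _ _ _] := hY.
apply: (is_derive_eq (is_deriveD (is_deriveD (is_derive_snd z v)
  (is_derive_polyfun Q z v)) (C1_is_derive z v cY))).
rewrite /b1 /b2; ring.
Qed.

Lemma continuous_planar_map : continuous F.
Proof.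
have [cX _ _ _] := hX; have [cY _ _ _] := hY.
apply: continuous_pair => z.
  apply: cvgD; last exact: C1_continuous.
  by apply: cvgB; [exact: continuous_fst|exact: continuous_polyfun].
apply: cvgD; last exact: C1_continuous.
by apply: cvgD; [exact: continuous_snd|exact: continuous_polyfun].
Qed.

Hypothesis k_gt0 : (0 < k)%N.
Hypothesis k'_gt0 : (0 < k')%N.
Variables (C D : tensor R (2 * k) 2) (E H : tensor R (2 * k') 2).
Hypothesis coefC : is_coefficient_tensor (dpx P + dpy P) C.
Hypothesis coefD : is_coefficient_tensor (dpx P - dpy P) D.
Hypothesis coefE : is_coefficient_tensor (dpy Q + dpx Q) E.
Hypothesis coefH : is_coefficient_tensor (dpy Q - dpx Q) H.

Let even_gt0 n : (0 < n)%N -> (0 < 2 * n)%N. Proof. by rewrite muln_gt0. Qed.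

Let coef_pair0 n (p q : mpoly 2 R) (B B' : tensor R n 2) : (0 < n)%N ->
  is_coefficient_tensor (p + q) B -> is_coefficient_tensor (p - q) B' ->
  polyfun p (0, 0) = 0 /\ polyfun q (0, 0) = 0.
Proof.
move=> n0 /(coefficient_tensor0 n0) + /(coefficient_tensor0 n0).
by rewrite polyfunD polyfunB /= fctE => ? ?; split; lra.
Qed.

Let a0 : a1 (0, 0) = 0 /\ a2 (0, 0) = 0.
Proof.
have [_ _ oX oX'] := hX; have k2 := even_gt0 k_gt0.
have [p0 q0] := coef_pair0 k2 coefC coefD.
by rewrite /a1 /a2 p0 q0 (littleo0 k2 oX) (littleo0 k2 oX') subrr.
Qed.

Let b0 : b1 (0, 0) = 0 /\ b2 (0, 0) = 0.
Proof.
have [_ _ oY oY'] := hY; have k2 := even_gt0 k'_gt0.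
have [p0 q0] := coef_pair0 k2 coefE coefH.
by rewrite /b1 /b2 p0 q0 (littleo0 k2 oY) (littleo0 k2 oY') addr0.
Qed.

Let ca1 : continuous a1.
Proof.
have [[_ _ c _] _ _ _] := hX.
by move=> z; apply: cvgB; [exact: continuous_polyfun|exact: c].
Qed.

Let ca2 : continuous a2.
Proof.
have [[_ _ _ c] _ _ _] := hX.
by move=> z; apply: cvgB; [exact: continuous_polyfun|exact: c].
Qed.

Let cb1 : continuous b1.
Proof.
have [[_ _ c _] _ _ _] := hY.
by move=> z; apply: cvgD; [exact: continuous_polyfun|exact: c].
Qed.

Let cb2 : continuous b2.
Proof.
have [[_ _ _ c] _ _ _] := hY.
by move=> z; apply: cvgD; [exact: continuous_polyfun|exact: c].
Qed.

Lemma planar_map_cones :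
  tensor_posdef C -> tensor_posdef D -> tensor_posdef E -> tensor_posdef H ->
  exists2 r : R, 0 < r & forall z w, box r z -> box r w ->
    (vcone z w -> vcone (F z) (F w) /\ w.2 - z.2 < (F w).2 - (F z).2) /\
    (hcone (F z) (F w) -> hcone z w /\ (F w).1 - (F z).1 < w.1 - z.1).
Proof.
move=> posC posD posE posH.
have [_ _ oX oX'] := hX; have [_ _ oY oY'] := hY.
have domP := dominance coefC coefD posC posD oX oX'.
(* For [Q] the dominant derivative is the one in [y], so the two remainders are passed in the
   opposite order. *)
have domQ := dominance coefE coefH posE posH oY' oY.
have small : \forall z \near nbhs ((0, 0) : R * R), a1 z <= 2^-1.
  have h2 : 0 < 2^-1 :> R by rewrite invr_gt0.
  have /cvgrPdist_lt/(_ _ h2) := @ca1 (0, 0).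
  apply: filterS => z; rewrite (proj1 a0) sub0r normrN => h.
  exact: le_trans (ler_norm _) (ltW h).
have [r r0 rP] := nbhs_box (filterI (filterI domP domQ) small).
have a_dom z : box r z -> z != (0, 0) -> `|a2 z| < a1 z.
  move=> bz z0; have [[/(_ z0) h _] _] := rP z bz.
  have := ler_normB (polyfun (dpy P) z) (dy X z); have := ler_norm (dx X z).
  rewrite -/(a2 z) /a1; lra.
have b_dom z : box r z -> z != (0, 0) -> `|b1 z| < b2 z.
  move=> bz z0; have [[_ /(_ z0) h] _] := rP z bz.
  have := ler_normD (polyfun (dpx Q) z) (dx Y z); have := ler_norm (- dy Y z).
  rewrite normrN -/(b1 z) /b2; lra.
have a1_small z : box r z -> a1 z <= 2^-1 by move=> /rP[].
exists r => // z w bz bw; have [[a10 a20] [b10 b20]] := (a0, b0); split.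
  move=> zw; have [h1 h2 h3] :=
    vcone_expansion dF1 dF2 a10 a20 b10 b20 a_dom b_dom a1_small bz bw zw.
  have [/= h4 _ _] := zw; split=> //.
  by move: (F z) (F w) h1 h2 h3 => Fz Fw ? ? ?; split=> /=; lra.
exact: (hcone_preimage dF1 dF2 a10 a20 b10 b20 a_dom b_dom a1_small bz bw).
Qed.

Lemma planar_map0 : homogeneous (2 * k + 1) P -> homogeneous (2 * k' + 1) Q ->
  F (0, 0) = (0, 0).
Proof.
move=> homP homQ; have [_ X0 _ _] := hX; have [_ Y0 _ _] := hY.
rewrite /F /planar_map /= X0 Y0 (homogeneous0 _ homP) ?addn1//.
by rewrite (homogeneous0 _ homQ) ?addn1// subr0 !addr0.
Qed.

Lemma planar_map_sign1 (c : R) : F (0, 0) = (0, 0) -> 0 <= c ->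
  exists2 r : R, 0 < r & forall w, box r w -> `|w.2| <= c * `|w.1| ->
    w.1 != 0 -> 0 < (F w).1 * w.1.
Proof.
move=> F0 c0; have [a10 a20] := a0.
apply: (@sign_preserving fst snd (fun z => (F z).1) (- a1) (- a2)) => //.
- by move=> z v; apply: (is_derive_eq (dF1 z v)); rewrite /= !fctE; ring.
- by move=> z; apply: cvgN; exact: ca1.
- by move=> z; apply: cvgN; exact: ca2.
- by rewrite !fctE a10 oppr0.
- by rewrite !fctE a20 oppr0.
- by rewrite F0.
Qed.

Lemma planar_map_sign2 (c : R) : F (0, 0) = (0, 0) -> 0 <= c ->
  exists2 r : R, 0 < r & forall w, box r w -> `|w.1| <= c * `|w.2| ->
    w.2 != 0 -> 0 < (F w).2 * w.2.
Proof.
move=> F0 c0; have [b10 b20] := b0.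
apply: (@sign_preserving snd fst (fun z => (F z).2) b2 b1) => //.
- by move=> z v; apply: (is_derive_eq (dF2 z v)); rewrite [b1 z * _ + _]addrC.
- by rewrite F0.
Qed.

End PlanarMap.

(** * One-dimensional maps induced on invariant curves *)

(** * Dynamics on the stable and unstable graphs *)

Section GraphDynamics.
Context {R : realType}.

Lemma sym_segmentP (d t : R) : sym_segment d t <-> - d <= t <= d.
Proof. by rewrite /sym_segment /= ler_norml. Qed.

(* If phi r >= r, then phi - id would vanish somewhere on [r, d], since phi maps
   [- d, d] into itself; but a fixed point does not converge to 0. *)
Lemma attracting_contraction (d r : R) (phi : R -> R) :
  0 < r -> r <= d -> {within sym_segment d, continuous phi} ->
  (forall t, sym_segment d t -> sym_segment d (phi t)) ->
  (forall t, sym_segment d t -> iter n phi t @[n --> \oo] --> 0) ->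
  phi 0 = 0 ->
  (forall s t, sym_segment r s -> sym_segment r t -> phi s = phi t -> s = t) ->
  (forall t, sym_segment r t -> t != 0 -> 0 < phi t * t) ->
  interval_contraction r phi.
Proof.
move=> r0 rd cphi phi_maps phi_lim phi0 phi_inj phi_sign.
have nofix t : sym_segment d t -> phi t = t -> t = 0.
  move=> dt tE; have := phi_lim t dt.
  rewrite (_ : (fun n => _) = cst t) => [h|]; last first.
    by apply/funext => n; elim: n => //= n ->.
  exact: (cvg_unique (@norm_hausdorff _ _) (@cvg_cst _ _ _ _ _) h).
have cmp (a b : R) : - d <= a -> b <= d ->
    {within `[a, b], continuous (fun t => phi t - t)}.
  move=> da bd t; apply: cvgB; last first.
    by apply: continuous_subspaceT => ?; exact: cvg_id.
  apply: (continuous_subspaceW _ cphi) => u /=; rewrite in_itv /= => /andP[? ?].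
  by apply/sym_segmentP/andP; split; lra.
have cr : {within `[- r, r], continuous phi}.
  apply: (continuous_subspaceW _ cphi) => u /=; rewrite in_itv /= => /andP[? ?].
  by apply/sym_segmentP/andP; split; lra.
have rr : sym_segment r r by apply/sym_segmentP/andP; split; lra.
have rNr : sym_segment r (- r) by apply/sym_segmentP/andP; split; lra.
have phir : 0 < phi r by have := phi_sign _ rr (lt0r_neq0 r0); rewrite pmulr_lgt0.
have phiNr : phi (- r) < 0.
  have Nr0 : - r < 0 by rewrite oppr_lt0.
  by have := phi_sign _ rNr (ltr0_neq0 Nr0); rewrite nmulr_lgt0.
split=> //.
(* A continuous injection of an interval is strictly monotone; the signs at [- r] and [r] make it
   increasing. *)
- have inj : {in `[- r, r] &, injective phi}.
    move=> s t; rewrite !in_itv /= => /sym_segmentP rs /sym_segmentP rt.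
    exact: phi_inj.
  have mono := segment_continuous_inj_le (ltW (lt_trans phiNr phir)) cr inj.
  move=> x y rx xy yr; rewrite (leW_mono_in mono)// in_itv /=; apply/andP; split; lra.
- have dd : sym_segment d d by apply/sym_segmentP/andP; split; lra.
  have dNd : sym_segment d (- d) by apply/sym_segmentP/andP; split; lra.
  have /sym_segmentP/andP[_ hd] := phi_maps _ dd.
  have /sym_segmentP/andP[hNd _] := phi_maps _ dNd.
  split; rewrite ltNge; apply/negP => ge.
    have [||t] := @IVT R (fun t => phi t - t) r d 0 rd; first by apply: cmp; lra.
      by rewrite ge_min le_max; apply/andP; split; apply/orP; [right|left]; lra.
    rewrite in_itv /= => /andP[? ?] /eqP; rewrite subr_eq0 => /eqP /nofix t0.
    by have : t = 0 by [apply: t0; apply/sym_segmentP/andP; split; lra]; lra.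
  have [|||t] := @IVT R (fun t => phi t - t) (- d) (- r) 0; first by lra.
  + by apply: cmp; lra.
  + by rewrite ge_min le_max; apply/andP; split; apply/orP; [right|left]; lra.
  rewrite in_itv /= => /andP[? ?] /eqP; rewrite subr_eq0 => /eqP /nofix t0.
  by have : t = 0 by [apply: t0; apply/sym_segmentP/andP; split; lra]; lra.
- move=> x /sym_segmentP rx; apply: phi_lim.
  by move: rx; rewrite /sym_segment /=; lra.
Qed.

Variables (W : set (R * R)) (T : R * R -> R * R) (c : R * R -> R)
  (p : R -> R * R) (d : R).
Hypothesis pW : forall t, sym_segment d t -> W (p t) /\ c (p t) = t.
Hypothesis Wp : forall w, W w -> sym_segment d (c w) /\ p (c w) = w.
Hypothesis TW : forall w, W w -> W (T w).
Hypothesis T_lim : forall w, W w -> iter n T w @[n --> \oo] --> ((0, 0) : R * R).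
Hypothesis c_cont : continuous c.
Hypothesis c0 : c (0, 0) = 0.
Hypothesis p_cont : {within sym_segment d, continuous p}.
Hypothesis T_cont : {within W, continuous T}.

(** The map [T] on the curve [W], read in the parameter of the curve. It is [F_1] for [F] on the
    stable graph, and the inverse of [F_2] for the local inverse on the unstable graph. *)
Let phi t := c (T (p t)).

Lemma graph_map_in t : sym_segment d t -> sym_segment d (phi t) /\ p (phi t) = T (p t).
Proof. by move=> /pW[/TW/Wp]. Qed.

Lemma graph_map_continuous : {within sym_segment d, continuous phi}.
Proof.
apply: (@within_continuous_comp _ _ _ _ (T \o p) c).
  by move=> z _; exact: c_cont.
by apply: within_comp p_cont T_cont => t /pW[].
Qed.

Lemma graph_map_lim t : sym_segment d t -> iter n phi t @[n --> \oo] --> 0.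
Proof.
move=> dt; have it n : sym_segment d (iter n phi t) /\
    p (iter n phi t) = iter n T (p t).
  elim: n => [|n [IH1 IH2]]; first by [].
  by rewrite !iterS -IH2; exact: graph_map_in.
rewrite (_ : (fun n => _) = (fun n => c (iter n T (p t)))); last first.
  by apply/funext => n; have [/pW[_ h] <-] := it n.
rewrite -c0; apply: (cvg_comp (fun n => iter n T (p t)) c).
  by apply: T_lim; have [] := pW dt.
exact: c_cont.
Qed.

End GraphDynamics.

(** * Invariant sets that are Lipschitz graphs *)

Section InvariantSets.
Context {R : realType}.

(** Covers the unstable set too, which unfolds to the stable set of the local inverse. *)
Lemma stable_set_invariant (T : R * R -> R * R) (N0 : set (R * R)) w :
  stable_set T N0 w -> stable_set T N0 (T w).
Proof.
move=> [_ Nw lim]; split; first exact: Nw 1%N.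
  by move=> j; rewrite -iterSr; exact: Nw.
move=> A /lim[n _ nA]; exists n => // j /= nj.
by rewrite -iterSr; apply: (nA j.+1); exact: leqW.
Qed.

Lemma stable_set0 (T : R * R -> R * R) (N0 : set (R * R)) :
  N0 (0, 0) -> T (0, 0) = (0, 0) -> stable_set T N0 (0, 0).
Proof.
move=> N00 T0; have it j : iter j T (0, 0) = (0, 0) by elim: j => //= j ->.
split=> // [j|]; first by rewrite it.
by rewrite (_ : (fun j => _) = cst (0, 0)); [exact: cvg_cst|apply/funext].
Qed.

Variables (c c' : R * R -> R) (mk : R -> R -> R * R).
Hypothesis cmk : forall a b, c (mk a b) = a.
Hypothesis c'mk : forall a b, c' (mk a b) = b.
Hypothesis mk0 : mk 0 0 = (0, 0).
Hypothesis mk_cont : continuous (fun z => mk z.1 z.2).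

(** [mk] is pairing in either order, which treats both graphs at once. As the origin lies on the
    graph, [phi 0 = 0], and the Lipschitz constant confines the curve to a sector; this is where
    [sign_preserving] will be applied. *)
Lemma graph_curve (W : set (R * R)) (d : R) (phi : R -> R) :
  0 < d -> [lipschitz phi t | t in sym_segment d] ->
  W = [set mk t (phi t) | t in sym_segment d] -> W (0, 0) ->
  let p t := get [set z | W z /\ c z = t] in
  [/\ forall t, sym_segment d t -> W (p t) /\ c (p t) = t,
      forall w, W w -> sym_segment d (c w) /\ p (c w) = w,
      {within sym_segment d, continuous p} &
      exists2 M : R, 0 <= M & forall t, sym_segment d t -> `|c' (p t)| <= M * `|t|].
Proof.
move=> d0 lip WE W0 p.
have pE t : sym_segment d t -> p t = mk t (phi t).
  move=> dt; have : exists z, [set z | W z /\ c z = t] z.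
    by exists (mk t (phi t)); rewrite /= cmk WE; split=> //; exists t.
  move=> /getPex; rewrite -/(p t) WE => -[/= [s ds <-]].
  by rewrite cmk => ->.
have d00 : sym_segment d 0 by rewrite /sym_segment /= normr0 ltW.
have phi0 : phi 0 = 0.
  have := W0; rewrite WE => -[s ds]; rewrite -mk0 => e.
  have := congr1 c e; have := congr1 c' e.
  by rewrite !cmk !c'mk => h s0; rewrite -{1}s0 h.
have [M M0 Mlip] : exists2 M : R, 0 < M & forall s t, sym_segment d s ->
    sym_segment d t -> `|phi s - phi t| <= M * `|s - t|.
  have [M M0 h] := pinfty_ex_gt0 lip; exists M => // s t ds dt.
  exact: (h (s, t)).
split.
- by move=> t dt; rewrite pE// cmk WE; split=> //; exists t.
- by move=> w; rewrite {1}WE => -[t dt <-]; rewrite cmk pE.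
- apply: (@subspace_eq_continuous _ _ _ (fun t => mk t (phi t))).
    by move=> t /set_mem dt; rewrite /from_subspace /= pE.
  apply: (@within_continuous_comp _ _ _ _ (fun t => (t, phi t)) (fun z => mk z.1 z.2)).
    by move=> z _; exact: mk_cont.
  apply/subspace_continuousP => t dt.
  have hi : id @ within (sym_segment d) (nbhs t) --> t by exact: cvg_within.
  have hp : phi @ within (sym_segment d) (nbhs t) --> phi t.
    apply/cvgrPdist_lt => e e0.
    have eM : 0 < e / M by rewrite divr_gt0.
    have sd : within (sym_segment d) (nbhs t) (sym_segment d) by exact: withinT.
    have /cvgrPdist_lt/(_ _ eM) := hi; apply: filterS2 sd => s ds /= ts.
    apply: (le_lt_trans (Mlip _ _ dt ds)).
    by rewrite mulrC -ltr_pdivlMr.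
  exact: (cvg_pair hi hp).
- exists M; first exact: ltW.
  move=> t dt; rewrite pE// c'mk; have := Mlip t 0 dt d00.
  by rewrite phi0 !subr0.
Qed.

End InvariantSets.

Lemma curve_in_box (R : realType) (c c' : R * R -> R) (p : R -> R * R)
    (d M rho : R) :
  (forall z, box rho z <-> `|c z| <= rho /\ `|c' z| <= rho) ->
  (forall t, sym_segment d t -> c (p t) = t) -> 0 <= M ->
  (forall t, sym_segment d t -> `|c' (p t)| <= M * `|t|) -> 0 < rho ->
  exists2 r : R, 0 < r &
    forall t, sym_segment r t -> sym_segment d t -> box rho (p t).
Proof.
move=> boxE cp M0 Mp rho0; have M1 : 0 < M + 1 by lra.
(* Then [(M + 1) * |t| <= rho] bounds both [|t|] and [M * |t|] by [rho]. *)
exists (rho / (M + 1)); first by rewrite divr_gt0.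
move=> t; rewrite {1}/sym_segment /= ler_pdivlMr// => tr dt.
have t0 := normr_ge0 t; have Mt : 0 <= M * `|t| by rewrite mulr_ge0.
apply/boxE; split; first by rewrite cp//; lra.
have := Mp t dt; lra.
Qed.

Lemma box_fst_snd (R : realType) (rho : R) (z : R * R) :
  box rho z <-> `|z.1| <= rho /\ `|z.2| <= rho.
Proof.
by rewrite !ler_norml; split=> [[-> -> -> ->]|[/andP[? ?] /andP[? ?]]].
Qed.

Lemma box_snd_fst (R : realType) (rho : R) (z : R * R) :
  box rho z <-> `|z.2| <= rho /\ `|z.1| <= rho.
Proof. by rewrite box_fst_snd; split=> -[]. Qed.

(** * Conjugacy with the product of the induced maps *)

Theorem theorem1p2 (R : realType) (k k' : nat) (P Q : mpoly 2 R)
    (X Y : R * R -> R)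
    (k_ge1 : (1 <= k)%N) (k'_ge1 : (1 <= k')%N)
    (homP : homogeneous (2 * k + 1) P) (homQ : homogeneous (2 * k' + 1) Q)
    (hX : higher_order (2 * k) X) (hY : higher_order (2 * k') Y)
    (A C D : tensor R (2 * k) 2) (B E H : tensor R (2 * k') 2)
    (coefA : is_coefficient_tensor (dpx P) A)
    (coefB : is_coefficient_tensor (dpy Q) B)
    (coefC : is_coefficient_tensor (dpx P + dpy P) C)
    (coefD : is_coefficient_tensor (dpx P - dpy P) D)
    (coefE : is_coefficient_tensor (dpy Q + dpx Q) E)
    (coefH : is_coefficient_tensor (dpy Q - dpx Q) H)
    (posA : tensor_posdef A) (posB : tensor_posdef B)
    (posC : tensor_posdef C) (posD : tensor_posdef D)
    (posE : tensor_posdef E) (posH : tensor_posdef H)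
    (Finv : R * R -> R * R) (U V : set (R * R))
    (invF : local_inverse (planar_map P Q X Y) Finv U V)
    (N0 : set (R * R)) (N0_nbhs : nbhs ((0, 0) : R * R) N0)
    (N0_V : N0 `<=` V) (delta0 : R) (delta0_gt0 : 0 < delta0)
    (graph_s : is_x_graph (stable_set (planar_map P Q X Y) N0) delta0)
    (graph_u : is_y_graph (unstable_set Finv N0) delta0) :
  let F := planar_map P Q X Y in
  let F1 := stable_map F (stable_set F N0) in
  let F2 := unstable_map F (unstable_set Finv N0) in
  exists N N' : set (R * R),
    [/\ nbhs ((0, 0) : R * R) N, nbhs ((0, 0) : R * R) N',
        N' `<=` sym_segment delta0 `*` sym_segment delta0 &
        conjugate_on F N (product_map F1 F2) N'].
Proof.
move=> F F1 F2.
have F0 : F (0, 0) = (0, 0) by exact: (planar_map0 hX hY homP homQ).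
have cF : continuous F by exact: (continuous_planar_map hX hY).
have [[oU oV] [U0 V0] bijF cG GF] := invF.
(* Surjectivity of [F] from [U] onto [V] turns the left inverse into a right inverse. *)
have FG z : V z -> F (Finv z) = z.
  by have [_ _ surj] := bijF => /surj[u Uu <-]; rewrite GF.
have G0 : Finv (0, 0) = (0, 0) by rewrite -[in LHS]F0 GF.
have N00 := nbhs_singleton N0_nbhs.
have [phis [lips WsE]] := graph_s; have [phiu [lipu WuE]] := graph_u.
set Ws := stable_set F N0 in WsE F1 *.
set Wu := unstable_set Finv N0 in WuE F2 *.
have Ws0 : Ws (0, 0) by exact: stable_set0.
have Wu0 : Wu (0, 0) by exact: (stable_set0 N00 G0).
have [psW Wps ps_cont [Ms Ms0 psM]] := @graph_curve R fst snd pair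
  (fun a b => erefl) (fun a b => erefl) erefl
  (continuous_pair (@continuous_fst R) (@continuous_snd R)) Ws delta0 phis
  delta0_gt0 lips WsE Ws0.
have [puW Wpu pu_cont [Mu Mu0 puM]] := @graph_curve R snd fst (fun a b => (b, a))
  (fun a b => erefl) (fun a b => erefl) erefl
  (continuous_pair (@continuous_snd R) (@continuous_fst R)) Wu delta0 phiu
  delta0_gt0 lipu WuE Wu0.
set ps := (fun t => _) in psW Wps ps_cont psM.
set pu := (fun t => _) in puW Wpu pu_cont puM.
have WuV w : Wu w -> V w by case=> /N0_V.
(* The inverse of [F2]: since [F2] expands, it is [K] that will be the interval contraction in the
   vertical direction. *)
pose K t := (Finv (pu t)).2.
have TWs w : Ws w -> Ws (F w) by exact: stable_set_invariant.
have TWu w : Wu w -> Wu (Finv w) by exact: stable_set_invariant.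
have lims w : Ws w -> iter n F w @[n --> \oo] --> ((0, 0) : R * R) by case.
have limu w : Wu w -> iter n Finv w @[n --> \oo] --> ((0, 0) : R * R) by case.
have F1in t : sym_segment delta0 t -> sym_segment delta0 (F1 t) /\ ps (F1 t) = F (ps t).
  exact: (graph_map_in psW Wps TWs).
have Kin t : sym_segment delta0 t -> sym_segment delta0 (K t) /\ pu (K t) = Finv (pu t).
  exact: (graph_map_in puW Wpu TWu).
have F1c : {within sym_segment delta0, continuous F1}.
  apply: (graph_map_continuous psW (@continuous_fst R) ps_cont).
  exact: continuous_subspaceT.
have Kc : {within sym_segment delta0, continuous K}.
  apply: (graph_map_continuous puW (@continuous_snd R) pu_cont).
  exact: continuous_subspaceW cG.
have F1lim t : sym_segment delta0 t -> iter n F1 t @[n --> \oo] --> 0.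
  exact: (graph_map_lim psW Wps TWs lims (@continuous_fst R) erefl).
have Klim t : sym_segment delta0 t -> iter n K t @[n --> \oo] --> 0.
  exact: (graph_map_lim puW Wpu TWu limu (@continuous_snd R) erefl).
have d00 : sym_segment delta0 0 by rewrite /sym_segment /= normr0 ltW.
have ps0 : ps 0 = (0, 0) by have [_] := Wps _ Ws0.
have pu0 : pu 0 = (0, 0) by have [_] := Wpu _ Wu0.
have F10 : F1 0 = 0 by rewrite -[LHS]/(F (ps 0)).1 ps0 F0.
have K0 : K 0 = 0 by rewrite /K pu0 G0.
have [rc rc0 cones] := planar_map_cones hX hY k_ge1 k'_ge1 coefC coefD coefE coefH
  posC posD posE posH.
rewrite -/F in cones.
have [rs rs0 sign1] := planar_map_sign1 hX k_ge1 coefC coefD F0 Ms0.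
have [ru ru0 sign2] := planar_map_sign2 hY k'_ge1 coefE coefH F0 Mu0.
have [rUV rUV0 UVbox] : exists2 r : R, 0 < r & box r `<=` U `&` V.
  by apply: nbhs_box; apply: filterI; exact: open_nbhs_nbhs.
have [rG rG0 Gbox] : exists2 r : R, 0 < r & box r `<=` [set z | box rc (Finv z)].
  apply: nbhs_box; have : {for (0, 0), continuous Finv}.
    by move: cG; rewrite continuous_open_subspace// => /(_ (0, 0)); apply; rewrite inE.
  by apply; rewrite G0; exact: box_nbhs.
have [r1 r10 ps_s] := curve_in_box (@box_fst_snd R rs)
  (fun t dt => (psW t dt).2) Ms0 psM rs0.
have [r2 r20 ps_U] := curve_in_box (@box_fst_snd R rUV)
  (fun t dt => (psW t dt).2) Ms0 psM rUV0.
have [r3 r30 pu_u] := curve_in_box (@box_snd_fst R ru)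
  (fun t dt => (puW t dt).2) Mu0 puM ru0.
(* The sign of [K t] is found by applying [F] at the point of the unstable graph over [K t], so
   [K t], and not only [t], must be small enough for [pu_u]. *)
have [r4 r40 K_small] : exists2 r : R, 0 < r & forall t, sym_segment r t ->
    sym_segment delta0 t -> sym_segment r3 (K t).
  have /cvgrPdist_lt/(_ _ r30) := (subspace_continuousP _ _).1 Kc 0 d00.
  rewrite /within /= => /nbhs_ballP[e /= e0 eK].
  exists (e / 2); first by rewrite divr_gt0.
  move=> t te dt; rewrite /sym_segment /=.
  have := eK t _ dt; rewrite /from_subspace K0 sub0r normrN => h.
  apply/ltW/h; rewrite /ball /= sub0r normrN.
  by apply: le_lt_trans te _; lra.
pose r := Num.min (Num.min delta0 (Num.min rc rUV))
  (Num.min (Num.min rG r1) (Num.min r2 r4)).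
have r0 : 0 < r by rewrite !lt_min delta0_gt0 rc0 rUV0 rG0 r10 r20 r40.
have [rd rrc rrU] : [/\ r <= delta0, r <= rc & r <= rUV].
  by split; rewrite /r !ge_min lexx ?orbT.
have [rrG rr1 rr2 rr4] : [/\ r <= rG, r <= r1, r <= r2 & r <= r4].
  by split; rewrite /r !ge_min lexx ?orbT.
have seg_sub (a b t : R) : a <= b -> sym_segment a t -> sym_segment b t.
  by move=> ab ta; exact: le_trans ta ab.
have F1contr : interval_contraction r F1.
  apply: (attracting_contraction r0 rd F1c) => //.
  - by move=> t /F1in[].
  (* [F1] is injective because [F] is injective on [U], which contains the curve over the small
     segment. *)
  - move=> s t rs' rt st.
    have ds := seg_sub _ _ _ rd rs'; have dt := seg_sub _ _ _ rd rt.
    have Us := (UVbox _ (ps_U s (seg_sub _ _ _ rr2 rs') ds)).1.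
    have Ut := (UVbox _ (ps_U t (seg_sub _ _ _ rr2 rt) dt)).1.
    have [_ es] := F1in s ds; have [_ et] := F1in t dt.
    have e : F (ps s) = F (ps t) by rewrite -es -et st.
    have e' := etrans (esym (GF _ Us)) (etrans (congr1 Finv e) (GF _ Ut)).
    exact: etrans (esym (psW s ds).2) (etrans (congr1 fst e') (psW t dt).2).
  - move=> t rt t0; have dt := seg_sub _ _ _ rd rt; have [_ pt] := psW t dt.
    have := sign1 (ps t) (ps_s t (seg_sub _ _ _ rr1 rt) dt).
    by rewrite pt; apply => //; exact: psM.
have KK t : sym_segment delta0 t -> F (pu (K t)) = pu t.
  by move=> dt; have [_ ->] := Kin t dt; rewrite FG//; apply: WuV; have [] := puW t dt.
have F2K t : sym_segment delta0 t -> F2 (K t) = t.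
  by move=> dt; rewrite -[LHS]/(F (pu (K t))).2 KK//; have [] := puW t dt.
have Kcontr : interval_contraction r K.
  apply: (attracting_contraction r0 rd Kc) => //.
  - by move=> t /Kin[].
  - move=> s t rs' rt st.
    by rewrite -(F2K s (seg_sub _ _ _ rd rs')) -(F2K t (seg_sub _ _ _ rd rt)) st.
  - move=> t rt t0; have dt := seg_sub _ _ _ rd rt.
    have [dK pK] := Kin t dt; have [_ pKt] := puW _ dK.
    have Kn : K t != 0.
      apply: contraNneq t0 => Kt0; have := F2K t dt.
      by rewrite Kt0 -[LHS]/(F (pu 0)).2 pu0 F0 => <-.
    (* The second coordinate of [F (pu (K t)) = pu t] is [t], so this inequality says that [t] and
       [K t] have the same sign. *)
    have : 0 < (F (pu (K t))).2 * (pu (K t)).2.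
      apply: sign2; rewrite ?pKt//; last exact: puM.
      exact: pu_u (K_small t (seg_sub _ _ _ rr4 rt) dt) dK.
    by rewrite KK// pKt (puW t dt).2 mulrC.
have bUV := subset_trans (box_sub rrU) UVbox.
have [N' [N'0 N'sub conj]] : exists N', [/\ nbhs ((0, 0) : R * R) N',
    N' `<=` box r & conjugate_on F (box r) (product_map F1 F2) N'].
  apply: (@cone_conjugacy _ r rc F Finv F1 K F2) => //.
  - exact: continuous_subspaceT.
  - by apply: continuous_subspaceW cG => z /bUV[].
  - by move=> z /bUV[Uz _]; exact: GF.
  - by move=> z /bUV[_ Vz]; exact: FG.
  - by move=> z /(box_sub rrG); exact: Gbox.
  - by move=> y yr; apply: F2K; apply: (seg_sub r) => //; exact/sym_segmentP.
exists (box r), N'; split=> //; first exact: box_nbhs.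
move=> z /N'sub[? ? ? ?].
by split; apply: (seg_sub r _ _ rd); apply/sym_segmentP/andP.
Qed.
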